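(* Consider the soft-core Widom-Rowlinson model on the Cayley tree of order $d$. For every $\beta>0$ and $\lambda>0$ there exists a time $t_g(\beta,\lambda,d)\in(0,\infty]$ such that for all $t<t_g(\beta,\lambda,d)$ the time-evolved intermediate measure $\mu^{\#}_{\beta,\lambda,t}$ is a Gibbs measure, i.e. it is compatible with some quasilocal specification.
   Context: The Cayley tree of order $d$ is the infinite tree $(V,E)$ in which each vertex has exactly $d+1$ neighbours. $\Omega=\{-1,0,1\}^V$ carries the product $\sigma$-algebra $\mathcal F$ and product topology; $\sigma_\Lambda$ denotes the restriction map $\omega\mapsto\omega_\Lambda=(\omega_i)_{i\in\Lambda}$, $\mathcal F_\Lambda$ the $\sigma$-algebra generated by $\sigma_\Lambda$, and $\Lambda\Subset V$ means $\Lambda$ is a finite subset. A specification is a family $\gamma=(\gamma_\Lambda)_{\Lambda\Subset V}$ of probability kernels $\gamma_\Lambda$ from $\mathcal F_{\Lambda^c}$ to $\mathcal F$ with $\gamma_\Lambda(A\mid\cdot)=1_A$ for $A\in\mathcal F_{\Lambda^c}$ and $\gamma_\Delta\gamma_\Lambda=\gamma_\Delta$ for $\Lambda\subset\Delta\Subset V$. It is quasilocal if each $\gamma_\Lambda$ maps quasilocal functions to quasilocal functions, where a function is quasilocal if it is a uniform limit of local functions ($\mathcal F_\Lambda$-measurable for some $\Lambda\Subset V$), equivalently continuous in the product topology. A probability measure $\mu$ is compatible with $\gamma$ if $\mu=\mu\gamma_\Lambda$ for all $\Lambda\Subset V$; $\mu$ is a Gibbs measure if it is compatible with some quasilocal specification.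 Soft-core Widom-Rowlinson model (zero magnetic field), $\beta>0$ (repulsion), $\lambda>0$ (activity): the specification $$\gamma_\Lambda(\sigma_\Lambda=\omega_\Lambda\mid\eta_{\Lambda^c})=\frac1{Z_\Lambda(\eta_{\Lambda^c})}\exp\Big(-\beta\sum_{\{i,j\}\in E,\{i,j\}\cap\Lambda\ne\emptyset}1_{\{\tilde\omega_i\tilde\omega_j=-1\}}\Big)\prod_{i\in\Lambda}\lambda^{\omega_i^2},\qquad \tilde\omega=\omega_\Lambda\eta_{\Lambda^c}.$$ A probability measure $\mu$ on $\Omega$ is a tree-indexed Markov chain if for each oriented edge $ij$ one has $\mu(\sigma_j=x\mid\mathcal F_{(-\infty,ij)})=\mu(\sigma_j=x\mid\mathcal F_{\{i\}})$ $\mu$-a.s. for all $x$, where $(-\infty,ij)$ is the set of vertices $k$ whose self-avoiding path to $i$ does not contain $j$. The intermediate measure $\mu^{\#}_{\beta,\lambda}$ is the unique Gibbs measure of the model that is a tree-indexed Markov chain, invariant under all tree automorphisms, and invariant under the spin flip $\omega\mapsto-\omega$. Concretely, let $\xi=\xi_{\beta,\lambda}$ be the unique positive solution of $x=\lambda\big(\frac{1+(1+e^{-\beta})x}{1+2x}\big)^d$; then $\mu^{\#}_{\beta,\lambda}$ is the homogeneous tree-indexed Markov chain with transition matrix $P$ given by $P(s,s)=\frac{\xi}{1+(1+e^{-\beta})\xi}$, $P(s,-s)=\frac{e^{-\beta}\xi}{1+(1+e^{-\beta})\xi}$, $P(s,0)=\frac{1}{1+(1+e^{-\beta})\xi}$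 for $s\in\{-1,1\}$, $P(0,\pm1)=\frac{\xi}{1+2\xi}$, $P(0,0)=\frac1{1+2\xi}$, with the $P$-invariant distribution as single-site marginal. Time evolution: for $t\ge0$, $\mu_t$ is the image of $\mu$ under the product kernel that acts independently at each site by $$p_t(\omega,\eta)=\tfrac12(1+e^{-2t})1_{\{\omega=\eta\ne0\}}+\tfrac12(1-e^{-2t})1_{\{\omega\eta=-1\}}+1_{\{\omega=\eta=0\}},\qquad \omega,\eta\in\{-1,0,1\}.$$ $\mu^{\#}_{\beta,\lambda,t}$ is the time-evolved measure started from $\mu^{\#}_{\beta,\lambda}$. *)

(* Defs.v *)
Set Warnings "-notation-overridden,-notation-incompatible-prefix,-ambiguous-paths,-redundant-canonical-projection".
From HB Require Import structures.
From mathcomp Require Import all_boot all_order all_algebra finmap.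
From mathcomp Require Import all_classical all_reals all_analysis.

Set Implicit Arguments.
Unset Strict Implicit.
Unset Printing Implicit Defensive.

Import Order.TTheory GRing.Theory Num.Theory.
Import numFieldNormedType.Exports.

Local Open Scope classical_set_scope.
Local Open Scope ring_scope.

(* This determines the tree up to isomorphism. *)
Record cayley_tree (d : nat) (V : choiceType) (e : rel V) : Prop := CayleyTree {
  cayley_irr : irreflexive e;
  cayley_sym : symmetric e;
  cayley_connected : forall i j, exists2 p, path e i p & last i p = j;
  (* [:: i; j] is a cycle in the sense of [ucycle] for every edge ij *)
  cayley_acyclic : forall c, ucycle e c -> (size c <= 2)%N;
  cayley_regular : forall i, ([set j | e i j] #= `I_d.+1)%card }.

Inductive spin := Minus | Zero | Plus.

Definition int_of_spin (s : spin) : int :=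
  match s with Minus => -1 | Zero => 0 | Plus => 1 end.

Coercion int_of_spin : spin >-> int.

Definition spin_of_int (z : int) : option spin :=
  if z == -1 then Some Minus
  else if z == 0 then Some Zero
  else if z == 1 then Some Plus
  else None.

Lemma int_of_spinK : pcancel int_of_spin spin_of_int.
Proof. by case. Qed.

HB.instance Definition _ := Countable.copy spin (pcan_type int_of_spinK).

Lemma spin_enumP : Finite.axiom [:: Minus; Zero; Plus].
Proof. by case. Qed.

HB.instance Definition _ := fintype.isFinite.Build spin spin_enumP.
HB.instance Definition _ := isPointed.Build spin Zero.

Definition flip (s : spin) : spin :=
  match s with Minus => Plus | Zero => Zero | Plus => Minus end.

Section configurations.
Variable V : choiceType.
Implicit Types (L D : {fset V}) (W : set V).

Definition site_events W : set_system (V -> spin) :=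
  [set A | exists i s, W i /\ A = [set w | w i = s]].

(* The set of all configurations on V, with the sigma-algebra F_W generated by
   the restriction to W. *)
Definition conf_on W : Type := g_sigma_algebraType (site_events W).

HB.instance Definition _ W := Measurable.on (conf_on W).

Definition conf : Type := conf_on setT.

HB.instance Definition _ := Measurable.on conf.

Definition local_cylinder L (x : {ffun L -> spin}) : set conf :=
  [set w | forall k : L, w (val k) = x k].

Definition glue L (x : {ffun L -> spin}) (h : conf) : conf :=
  fun i => if insub i is Some k then x k else h i.

Variable R : realType.

(* [conf_on W] and [conf] are the same set with different sigma-algebras: the
   type ascription on f is what makes f F_L-measurable. *)
Definition local_function (f : conf -> R) : Prop :=
  exists L, measurable_fun setT (f : conf_on [set` L] -> R).

Definition quasilocal_function (f : conf -> R) : Prop :=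
  exists2 g : nat -> conf -> R, (forall n, local_function (g n)) &
    {uniform, g @ \oo --> f}.

Definition kernel_family : Type :=
  forall L, R.-pker conf_on (~` [set` L]) ~> conf.

(* The integral in the second clause is (gamma_D gamma_L)(A | h). *)
Definition specification (g : kernel_family) : Prop :=
  (forall L (A : set conf), <<s site_events (~` [set` L]) >> A ->
     forall h, g L h A = (\1_A h)%:E) /\
  (forall L D, (L `<=` D)%fset -> forall (A : set conf), measurable A ->
     forall h, (\int[g D h]_w g L w A = g D h A)%E).

Definition quasilocal (g : kernel_family) : Prop :=
  forall L f, quasilocal_function f ->
    quasilocal_function (fun h => Rintegral (g L h) setT f).

Definition compatible (g : kernel_family) (mu : probability conf R) : Prop :=
  forall L (A : set conf), measurable A -> (\int[mu]_w g L w A = mu A)%E.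

Definition gibbs_measure (mu : probability conf R) : Prop :=
  exists g, [/\ specification g, quasilocal g & compatible g mu].

(* f is a version of mu(A | F_W). *)
Definition cond_prob (mu : probability conf R) (A : set conf) W
    (f : conf -> R) : Prop :=
  [/\ measurable_fun setT (f : conf_on W -> R),
      mu.-integrable setT (EFin \o f) &
      forall B : set conf, <<s site_events W >> B ->
        (\int[mu]_(w in B) (f w)%:E = mu (A `&` B))%E].

Variable e : rel V.

(* (-oo, ij) *)
Definition past (i j : V) : set V :=
  [set k | exists p, [/\ path e k p, uniq (k :: p), last k p = i
                       & j \notin k :: p]].

Definition tree_markov_chain (mu : probability conf R) : Prop :=
  forall i j, e i j -> forall (x : spin) (f g : conf -> R),
    cond_prob mu [set w | w j = x] (past i j) f ->
    cond_prob mu [set w | w j = x] [set i] g ->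
    {ae mu, forall w, f w = g w}.

Definition automorphism_invariant (mu : probability conf R) : Prop :=
  forall tau : V -> V, bijective tau -> {mono tau : i j / e i j} ->
  forall A : set conf, measurable A ->
    pushforward mu (fun w : conf => w \o tau : conf) A = mu A.

Definition flip_invariant (mu : probability conf R) : Prop :=
  forall A : set conf, measurable A ->
    pushforward mu (fun w : conf => flip \o w : conf) A = mu A.

Definition edges_meeting L : set {fset V} :=
  [set b | (exists i j, e i j /\ b = [fset i; j]%fset) /\
           (b `&` L != fset0)%fset].

(* The product over an edge b = {i, j} is w_i w_j. *)
Definition wr_energy L (w : conf) : R :=
  \sum_(b \in edges_meeting L) ((\prod_(i <- b) (w i : int) == -1)%:R : R).

Definition wr_weight (beta lambda : R) L (h : conf) (x : {ffun L -> spin}) : R :=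
  expR (- beta * wr_energy L (glue x h)) *
  \prod_(k : L) lambda ^ ((x k : int) ^+ 2).

Definition wr_partition (beta lambda : R) L (h : conf) : R :=
  \sum_(x : {ffun L -> spin}) wr_weight beta lambda h x.

(* The cylinder probabilities determine the kernels, since a specification is
   proper. *)
Definition wr_specification (beta lambda : R) (g : kernel_family) : Prop :=
  specification g /\
  forall L (x : {ffun L -> spin}) h,
    g L h (local_cylinder x) =
      ((wr_partition beta lambda L h)^-1 * wr_weight beta lambda h x)%:E.

(* These properties characterize a unique measure: the homogeneous tree-indexed
   Markov chain whose boundary law is the positive fixed point of
   x = lambda * ((1 + (1 + exp(- beta)) * x) / (1 + 2 * x)) ^ d. *)
Definition intermediate_measure (beta lambda : R) (mu : probability conf R)
    : Prop :=
  [/\ exists2 g, wr_specification beta lambda g & compatible g mu,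
      tree_markov_chain mu,
      automorphism_invariant mu &
      flip_invariant mu].

Definition flip_prob (t : R) (s r : spin) : R :=
  2^-1 * (1 + expR (- 2 * t)) * ((s == r) && (r != Zero))%:R +
  2^-1 * (1 - expR (- 2 * t)) * ((s : int) * (r : int) == -1)%:R +
  ((s == Zero) && (r == Zero))%:R.

(* K(w, .) is the product over the sites i of the laws p(w_i, .). *)
Definition product_kernel (p : spin -> spin -> R)
    (K : R.-pker conf ~> conf) : Prop :=
  forall w L (x : {ffun L -> spin}),
    K w (local_cylinder x) = (\prod_(k : L) p (w (val k)) (x k))%:E.

Definition time_evolved (t : R) (mu mut : probability conf R) : Prop :=
  exists2 K : R.-pker conf ~> conf, product_kernel (flip_prob t) K &
    forall A : set conf, measurable A -> (mut A = \int[mu]_w K w A)%E.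

End configurations.

(* Main.v *)
Set Warnings "-notation-overridden,-notation-incompatible-prefix,-ambiguous-paths,-redundant-canonical-projection".
From HB Require Import structures.
Require Import Defs.
From mathcomp Require Import all_boot all_order all_algebra finmap.
From mathcomp Require Import all_classical all_reals all_analysis.
From mathcomp Require Import measurable_realfun ring lra.
(* The analysis library has a [glue] of its own. *)
Import Defs.

Set Implicit Arguments.
Unset Strict Implicit.
Unset Printing Implicit Defensive.

Import Order.TTheory GRing.Theory Num.Theory.
Import numFieldNormedType.Exports.

Local Open Scope classical_set_scope.
Local Open Scope ring_scope.

(* The finite-volume conditional probabilities of the evolved measure are
   ratios of numbers mu (prod_k p_t (w_k, eta_k)), that is, conditional
   expectations of functions of the initial spins next to L, under mu reweighted
   by the evolved spins. For small t the reweighting pins each initial spin to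
   its evolved value up to an error O(t), whatever its neighbours are, so that
   resampling a single site depends only slightly on the neighbours. Dobrushin's
   comparison argument then shows that these conditional expectations converge,
   exponentially fast in the distance to the boundary and uniformly in the
   evolved configuration, and the limits define a quasilocal specification. *)

(** * Gluing configurations *)

(** A specification must give kernels for every evolved configuration, not for almost every one, so
    each estimate is uniform in the evolved configuration and in the finite window. All expectations
    of local functions are therefore written as finite sums over configurations extended by zeros,
    which leaves mostly algebra. Zero spins never move, so [flip_prob] vanishes for some pairs and a
    weight can be zero for a given initial configuration; positivity returns after averaging over
    the initial spins, because a spin keeps its value with probability at least 1/2. The same
    rigidity supplies a reference: an evolved zero forces an initial zero, and a block of zeros has
    Widom-Rowlinson weight 1 whatever surrounds it. Dividing by the weight of the evolved
    configuration with zeros on [L] produces the conditional means of [pin_sum], and keeps the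
    normalising sums at least 1. Exponential convergence comes from a contraction by 1/2 for each
    layer of neighbours; asking for this factor at degree [d + 1] is what fixes the explicit
    time. *)

Section gluing.
Variable V : choiceType.
Implicit Types (L D : {fset V}) (w h : conf V).

Definition restr L w : {ffun L -> spin} := [ffun k => w (val k)].

Definition depends_on (T : Type) (W : set V) (F : conf V -> T) : Prop :=
  forall w w', (forall i, W i -> w i = w' i) -> F w = F w'.

Lemma depends_onS (T : Type) (W W' : set V) (F : conf V -> T) :
  W `<=` W' -> depends_on W F -> depends_on W' F.
Proof. by move=> sW dF w w' ww'; apply: dF => i /sW; exact: ww'. Qed.

Lemma glue_in L (x : {ffun L -> spin}) h (k : L) : glue x h (val k) = x k.
Proof. by rewrite /glue valK. Qed.

Lemma glue_out L (x : {ffun L -> spin}) h i : i \notin L -> glue x h i = h i.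
Proof. by move=> iL; rewrite /glue insubN. Qed.

Lemma glueP L (x : {ffun L -> spin}) h w :
  (forall k : L, w (val k) = x k) -> (forall i, i \notin L -> w i = h i) ->
  glue x h = w.
Proof.
move=> wx wh; apply/funext => i; have [iL|iL] := boolP (i \in L).
  by rewrite -[i]/(val [` iL]%fset) glue_in wx.
by rewrite glue_out// wh.
Qed.

Lemma glue_congr L (x : {ffun L -> spin}) h h' i :
  (i \notin L -> h i = h' i) -> glue x h i = glue x h' i.
Proof. by rewrite /glue; case: insubP => // iL; apply. Qed.

Lemma restr_glue L (x : {ffun L -> spin}) h : restr L (glue x h) = x.
Proof. by apply/ffunP => k; rewrite ffunE glue_in. Qed.

Lemma glue_restr L w h : (forall i, i \notin L -> w i = h i) ->
  glue (restr L w) h = w.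
Proof. by move=> wh; apply: glueP => // k; rewrite ffunE. Qed.

Lemma glue_glue L (x y : {ffun L -> spin}) h : glue x (glue y h) = glue x h.
Proof.
apply: glueP => [k|i iL]; first by rewrite glue_in.
by rewrite !glue_out.
Qed.

Lemma glue_off L (x : {ffun L -> spin}) h h' :
  (forall i, i \notin L -> h i = h' i) -> glue x h = glue x h'.
Proof. by move=> hh; apply/funext => i; apply: glue_congr; exact: hh. Qed.

(* Reversibility of resampling inside L. *)
Lemma sum_glue_swap (R : realType) L D h (A : conf V -> conf V -> R) :
  (L `<=` D)%fset ->
  \sum_(y : {ffun D -> spin}) \sum_(x : {ffun L -> spin})
     A (glue y h) (glue x (glue y h)) =
  \sum_(y : {ffun D -> spin}) \sum_(x : {ffun L -> spin})
     A (glue x (glue y h)) (glue y h).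
Proof.
move=> /fsubsetP LD; rewrite !pair_big/=.
(* [T] exchanges the configurations before and after the resampling: it keeps the new configuration
   on [D] and remembers the overwritten spins of [L], hence is an involution. *)
pose T (p : {ffun D -> spin} * {ffun L -> spin}) :=
  (restr D (glue p.2 (glue p.1 h)), restr L (glue p.1 h)).
have TE p : glue (T p).1 h = glue p.2 (glue p.1 h).
  apply: glue_restr => i iD; rewrite !glue_out//.
  by apply: contra iD; exact: LD.
have TE2 p : glue (T p).2 (glue (T p).1 h) = glue p.1 h.
  by rewrite TE glue_glue glue_restr.
have TK : involutive T.
  move=> [y x]; rewrite [T (T _)]/T TE2 TE/= !restr_glue//.
rewrite (reindex_inj (inv_inj TK))/=.
by apply: eq_bigr => p _; rewrite TE2 TE.
Qed.

Variable R : realType.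

Definition cond_weight (n : conf V -> R) L w (x : {ffun L -> spin}) : R :=
  n (glue x w) / \sum_(z : {ffun L -> spin}) n (glue z w).

Lemma sum_weight_gt0 (n : conf V -> R) L w : (forall u, 0 < n u) ->
  0 < \sum_(z : {ffun L -> spin}) n (glue z w).
Proof.
move=> n0; rewrite (bigD1 (restr L w))//= ltr_pwDl// sumr_ge0// => z _.
exact: ltW.
Qed.

Lemma cond_weight_ge0 (n : conf V -> R) L w x : (forall u, 0 < n u) ->
  0 <= @cond_weight n L w x.
Proof. by move=> n0; rewrite divr_ge0// ltW// sum_weight_gt0. Qed.

Lemma sum_cond_weight (n : conf V -> R) L w : (forall u, 0 < n u) ->
  \sum_(x : {ffun L -> spin}) cond_weight n w x = 1.
Proof.
by move=> n0; rewrite -mulr_suml divff// gt_eqF// sum_weight_gt0.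
Qed.

(** Detailed balance: the sum [Z] over the spins in [L] does not see those spins, so
    [n u * n v / Z u] is symmetric for [u], [v] equal off [L], and [sum_glue_swap] applies. This is
    the relation $\gamma_D\gamma_L=\gamma_D$ before normalisation. *)
Lemma cond_weight_consistent (n : conf V -> R) L D h (F : conf V -> R) :
  (forall u, 0 < n u) -> (L `<=` D)%fset ->
  \sum_(y : {ffun D -> spin}) n (glue y h) *
    (\sum_(x : {ffun L -> spin}) cond_weight n (glue y h) x *
       F (glue x (glue y h))) =
  \sum_(y : {ffun D -> spin}) n (glue y h) * F (glue y h).
Proof.
move=> n0 LD.
pose Z w := \sum_(z : {ffun L -> spin}) n (glue z w).
pose A u v := n u * (n v / Z u * F v).
transitivity (\sum_(y : {ffun D -> spin}) \sum_(x : {ffun L -> spin})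
     A (glue y h) (glue x (glue y h))).
  by apply: eq_bigr => y _; rewrite mulr_sumr.
rewrite sum_glue_swap//; apply: eq_bigr => y _.
have ZE (x : {ffun L -> spin}) : Z (glue x (glue y h)) = Z (glue y h).
  by apply: eq_bigr => z _; rewrite glue_glue.
transitivity ((Z (glue y h))^-1 * Z (glue y h) * (n (glue y h) * F (glue y h))).
  rewrite /Z mulr_sumr mulr_suml; apply: eq_bigr => x _.
  by rewrite /A ZE; ring.
by rewrite mulVf ?mul1r// gt_eqF// sum_weight_gt0.
Qed.

End gluing.

(** * Measurability of local events *)

Section site_measurability.
Variable V : choiceType.
Implicit Types (L D : {fset V}) (w h : conf V) (W : set V).

(** Indexed by a whole configuration, so that one configuration serves for windows of every size. *)
Definition cyl L w : set (conf V) := [set u | forall k, k \in L -> u k = w k].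

Lemma local_cylinderE L (x : {ffun L -> spin}) h :
  local_cylinder x = cyl L (glue x h).
Proof.
apply/seteqP; split => u /= ux.
  by move=> k kL; rewrite -[k]/(val [` kL]%fset) ux glue_in.
by move=> k; rewrite ux ?glue_in// fsvalP.
Qed.

Lemma cyl_self L w : cyl L w w. Proof. by []. Qed.

Lemma cyl_congr L w w' : cyl L w w' -> cyl L w = cyl L w'.
Proof. by move=> ww'; apply/seteqP; split => u uw k kL; rewrite uw// ww'. Qed.

(** The sets that depend only on [W] form a sigma-algebra containing the generators. *)
Lemma sigma_site_depends W (A : set (conf V)) :
  <<s site_events W >> A -> depends_on W A.
Proof.
apply: (smallest_sub (C := fun G => _) (X := depends_on W)) => /=.
  split => //.
  - by move=> B dB w w' ww'; rewrite !setTD /setC/= (dB _ _ ww').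
  - move=> F dF w w' ww'; apply/propext.
    by split=> -[n _ Fn]; exists n => //; rewrite (dF n w w') in Fn * => // i
      /ww'.
move=> _ [i [s [Wi ->]]] w w' ww' /=.
by rewrite (ww' i Wi).
Qed.

Lemma site_events_measurable W i s : W i ->
  measurable ([set w : conf_on W | w i = s] : set (conf_on W)).
Proof. by move=> Wi; apply: sub_sigma_algebra; exists i, s. Qed.

Lemma cyl_measurable_on W L w : [set` L] `<=` W ->
  measurable (cyl L w : set (conf_on W)).
Proof.
move=> LW; rewrite (_ : cyl L w =
    \bigcap_(k in [set` L]) [set u : conf_on W | u k = w k]); last first.
  by apply/seteqP; split => u /= uw k; exact: uw.
apply: fin_bigcap_measurable; first exact: finite_fset.
by move=> k kL; apply: site_events_measurable; exact: LW.
Qed.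

Lemma cyl_measurable L w : measurable (cyl L w : set (conf V)).
Proof. exact: cyl_measurable_on. Qed.

(** As [L] is finite, such a set is a finite union of cylinders. *)
Lemma depends_measurable W L (A : set (conf V)) : [set` L] `<=` W ->
  depends_on [set` L] A -> measurable (A : set (conf_on W)).
Proof.
move=> LW dA; pose h0 : conf V := fun=> Zero.
rewrite (_ : A = \bigcup_(z in [set z : {ffun L -> spin} | A (glue z h0)])
    cyl L (glue z h0)); last first.
  apply/seteqP; split => [u Au|u [z Az uz]].
    have E k : k \in L -> glue (restr L u) h0 k = u k.
      by move=> kL; rewrite -[k]/(val [` kL]%fset) glue_in ffunE.
    exists (restr L u) => /=; last by move=> k kL; rewrite E.
    by rewrite (dA _ u)// => k; exact: E.
  by rewrite (dA _ (glue z h0))// => k; exact: uz.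
apply: fin_bigcup_measurable; first exact: finite_finset.
by move=> z _; exact: cyl_measurable_on.
Qed.

Lemma depends_measurable_fun W L d (T : measurableType d) (f : conf V -> T) :
  [set` L] `<=` W -> depends_on [set` L] f ->
  measurable_fun setT (f : conf_on W -> T).
Proof.
move=> LW df _ Y mY; rewrite setTI; apply: (depends_measurable LW).
by move=> w w' ww'; rewrite /preimage/= (df _ _ ww').
Qed.

(** The level set of [f] through [w] is an event of $\mathcal F_W$, so it cannot separate [w] from a
    configuration that agrees with it on [W]. *)
Lemma measurable_fun_depends (R : realType) W (f : conf V -> R) :
  measurable_fun setT (f : conf_on W -> R) -> depends_on W f.
Proof.
move=> mf w w' ww'.
have : measurable (f @^-1` [set f w] : set (conf_on W)).
  by rewrite -[X in measurable X]setTI; exact: mf.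
move=> /sigma_site_depends/(_ _ _ ww')/= E.
by have : f w' = f w by rewrite -E.
Qed.

Lemma site_events_sub W W' : W `<=` W' ->
  <<s @site_events V W >> `<=` <<s site_events W' >>.
Proof.
move=> WW'; apply: sub_sigma_algebra2 => _ [i [s [Wi ->]]].
by exists i, s; split => //; exact: WW'.
Qed.

Lemma measurable_fun_on W W' d (T : measurableType d) (f : conf V -> T) :
  W `<=` W' -> measurable_fun setT (f : conf_on W -> T) ->
  measurable_fun setT (f : conf_on W' -> T).
Proof.
move=> WW' mf _ Y mY; rewrite setTI.
have := mf measurableT Y mY; rewrite setTI.
exact: site_events_sub.
Qed.

Lemma measurable_glue L (x : {ffun L -> spin}) :
  measurable_fun setT (glue x : conf_on (~` [set` L]) -> conf V).
Proof.
apply: (@measurability _ _ (conf_on (~` [set` L])) (conf V) setT (glue x)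
  (site_events setT) erefl).
move=> _ [_ [i [s [_ ->]]] <-]; rewrite setTI.
have [iL|iL] := boolP (i \in L).
  have [E|E] := pselect (x [` iL]%fset = s).
    rewrite (_ : _ @^-1` _ = setT)//.
    by apply/seteqP; split => u _ //=; rewrite -[i]/(val [` iL]%fset) glue_in.
  rewrite (_ : _ @^-1` _ = set0)//.
  by apply/seteqP; split => u //=; rewrite -[i]/(val [` iL]%fset) glue_in.
rewrite (_ : _ @^-1` _ = [set w : conf_on (~` [set` L]) | w i = s]).
  by apply: site_events_measurable => /=; apply/negP.
by apply/seteqP; split => u /=; rewrite glue_out.
Qed.

End site_measurability.

(** * Finite mixtures and local integrals *)

Section finite_mixtures.
Local Open Scope ereal_scope.
Context d (T : measurableType d) (R : realType) (I : finType) (i0 : I).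
Variables (a : I -> {nonneg R}) (u : I -> T).

(** [msum] is indexed by natural numbers, hence the enumeration of [I]; the default [i0] is never
    reached. *)
Definition mixture : {measure set T -> \bar R} :=
  msum (fun n => mscale (a (nth i0 (enum I) n)) \d_(u (nth i0 (enum I) n)))
    (size (enum I)).

Lemma mixtureE A : mixture A = (\sum_i (a i)%:num * \1_A (u i))%R%:E.
Proof.
rewrite /mixture/= /msum/= -(big_mkord xpredT
  (fun n => mscale (a (nth i0 (enum I) n)) \d_(u (nth i0 (enum I) n)) A)).
rewrite -(big_nth i0 xpredT (fun i => mscale (a i) \d_(u i) A)) big_enum/=.
by rewrite -sumEFin.
Qed.

Lemma ge0_integral_mixture (f : T -> R) : measurable_fun setT f ->
  (forall x, 0 <= f x)%R ->
  \int[mixture]_x (f x)%:E = (\sum_i (a i)%:num * f (u i))%R%:E.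
Proof.
move=> mf f0; have mf' : measurable_fun setT (EFin \o f) by
  exact/measurable_EFinP.
rewrite ge0_integral_measure_sum//; last by move=> x _; rewrite lee_fin.
rewrite -(big_mkord xpredT (fun n => \int[mscale (a (nth i0 (enum I) n))
  \d_(u (nth i0 (enum I) n))]_x (f x)%:E)).
rewrite -(big_nth i0 xpredT (fun i => \int[mscale (a i) \d_(u i)]_x (f x)%:E)).
rewrite big_enum/= -sumEFin; apply: eq_bigr => i _.
rewrite ge0_integral_mscale//; last by move=> x _; rewrite lee_fin.
by rewrite integral_dirac// diracT mul1e.
Qed.

Lemma Rintegral_mixture (f : T -> R) : measurable_fun setT f ->
  Rintegral mixture setT f = (\sum_i (a i)%:num * f (u i))%R.
Proof.
move=> mf; rewrite /Rintegral integralE.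
under eq_integral do rewrite funeposE -EFin_max.
under [X in _ - X]eq_integral do rewrite funenegE -EFinN -EFin_max.
rewrite ge0_integral_mixture; last 2 first.
- exact: measurable_maxr.
- by move=> x; rewrite le_max lexx orbT.
rewrite ge0_integral_mixture; last 2 first.
- by apply: measurable_maxr => //; exact: measurable_funN.
- by move=> x; rewrite le_max lexx orbT.
rewrite -EFinB/= -sumrB; apply: eq_bigr => i _.
rewrite -mulrBr; congr (_ * _)%R; rewrite /Order.max.
by case: ltP => h1; case: ltP => h2; lra.
Qed.

End finite_mixtures.

Section local_integrals.
Variables (V : choiceType) (R : realType).
Implicit Types (L D : {fset V}) (w h : conf V) (mu : probability (conf V) R).

Definition cylp mu L w : R := fine (mu (cyl L w)).

Lemma cylpE mu L w : mu (cyl L w) = (cylp mu L w)%:E.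
Proof. by rewrite fineK// fin_num_measure//; exact: cyl_measurable. Qed.

Lemma cylp_ge0 mu L w : 0 <= cylp mu L w.
Proof. by rewrite fine_ge0. Qed.

Lemma depends_sum_cyl L (F : conf V -> R) h w : depends_on [set` L] F ->
  F w = \sum_(z : {ffun L -> spin}) F (glue z h) * \1_(cyl L (glue z h)) w.
Proof.
move=> dF; rewrite (bigD1 (restr L w))//= big1 ?addr0.
  rewrite indicE mem_set ?mulr1; last first.
    by move=> k kL; rewrite -[k]/(val [` kL]%fset) glue_in ffunE.
  by apply: dF => k kL; rewrite -[k]/(val [` kL]%fset) glue_in ffunE.
move=> z zw; rewrite indicE memNset ?mulr0//= => wz; case/eqP: zw.
by apply/ffunP => k; rewrite ffunE wz ?glue_in// fsvalP.
Qed.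

Lemma integral_depends mu L (F : conf V -> R) h : (forall w, 0 <= F w) ->
  depends_on [set` L] F ->
  (\int[mu]_w (F w)%:E =
   (\sum_(z : {ffun L -> spin}) F (glue z h) * cylp mu L (glue z h))%:E)%E.
Proof.
move=> F0 dF.
under eq_integral do rewrite (depends_sum_cyl h _ dF) -sumEFin.
rewrite ge0_integral_sum//; last 2 first.
- move=> z; apply/measurable_EFinP; apply: measurable_funM => //.
  by apply: measurable_indic; exact: cyl_measurable.
- by move=> z w _; rewrite lee_fin mulr_ge0.
rewrite -sumEFin; apply: eq_bigr => z _.
under eq_integral do rewrite EFinM.
rewrite ge0_integralZl_EFin//; last first.
  apply/measurable_EFinP; apply: measurable_indic; exact: cyl_measurable.
rewrite integral_indic//; last exact: cyl_measurable.
by rewrite setIT EFinM; congr (_ * _)%E; exact: cylpE.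
Qed.

Lemma sum_cylp mu L h : \sum_(z : {ffun L -> spin}) cylp mu L (glue z h) = 1.
Proof.
have E : (\int[mu]_w ((cst 1 : conf V -> R) w)%:E = 1)%E.
  rewrite -[LHS]/(\int[mu]_w cst 1%E w)%E integral_cst// mul1e.
  exact: probability_setT.
have := @integral_depends mu L (cst 1) h (fun=> ler01) (fun _ _ _ => erefl).
by rewrite E => -[->]; apply: eq_bigr => z _; rewrite mul1r.
Qed.

Lemma cylp_congr mu L w w' : (forall k, k \in L -> w k = w' k) ->
  cylp mu L w = cylp mu L w'.
Proof. by move=> ww'; rewrite /cylp (cyl_congr (w' := w'))// => k /ww'. Qed.

(** Turns weights that see only the outside of [L] into the kernel that resamples the spins of [L].
    Its atoms [glue x h] keep [h] off [L], which is the source of properness. *)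
Lemma mixture_kernel L (c : {ffun L -> spin} -> conf V -> R) :
  (forall x h, 0 <= c x h) -> (forall h, \sum_x c x h = 1) ->
  (forall x, measurable_fun setT (c x : conf_on (~` [set` L]) -> R)) ->
  exists k : R.-pker conf_on (~` [set` L]) ~> conf V,
   [/\ forall h A, k h A = (\sum_x c x h * \1_A (glue x h))%:E,
    forall h (f : conf V -> R), measurable_fun setT f ->
      Rintegral (k h) setT f = \sum_x c x h * f (glue x h) &
    forall h (f : conf V -> R), measurable_fun setT f -> (forall w, 0 <= f w) ->
      (\int[k h]_w (f w)%:E = (\sum_x c x h * f (glue x h))%:E)%E].
Proof.
move=> c0 c1 mc.
pose x0 : {ffun L -> spin} := [ffun=> Zero].
pose m (h : conf_on (~` [set` L])) : {measure set (conf V) -> \bar R} :=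
  mixture x0 (fun x => NngNum (c0 x h)) (fun x => glue x h : conf V).
have mE h A : m h A = (\sum_x c x h * \1_A (glue x h))%:E by exact: mixtureE.
have mker U : measurable U -> measurable_fun setT (fun h : conf_on (~` [set` L])
  => m h U).
  move=> mU; apply: (eq_measurable_fun
      (EFin \o (fun h : conf_on (~` [set` L]) => \sum_x c x h * \1_U (glue x
        h)))).
    by move=> h _; rewrite mE.
  apply/measurable_EFinP; apply: measurable_sum => x.
  have mi : measurable_fun setT (\1_U : conf V -> R) by exact: measurable_indic.
  have mg := measurableT_comp mi (@measurable_glue V L x).
  exact: (measurable_funM (mc x) mg).
have mprob h : m h setT = 1%E.
  rewrite mE; congr EFin; rewrite -(c1 h); apply: eq_bigr => x _.
  by rewrite indicT mulr1.
pose K1 := isKernel.Build _ _ _ _ R m mker.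
pose k1 : R.-ker conf_on (~` [set` L]) ~> conf V := HB.pack m K1.
pose K2 := Kernel_isProbability.Build _ _ _ _ R k1 mprob.
pose k2 : R.-pker conf_on (~` [set` L]) ~> conf V := HB.pack m K1 K2.
exists k2; split => [h A|h f mf|h f mf f0].
- exact: mE.
- by rewrite Rintegral_mixture.
- by rewrite ge0_integral_mixture.
Qed.

End local_integrals.

(** * Limits of conditional probabilities *)

Section thermodynamic_limit.
Variables (V : choiceType) (R : realType).
Implicit Types (L D : {fset V}) (w h : conf V).

Lemma eq_eps (a b K : R) : (forall eps, 0 < eps -> `|a - b| <= K * eps) -> a =
  b.
Proof.
move=> ab; apply/eqP; rewrite -subr_eq0 -normr_le0.
apply/ler_addgt0Pr => eps eps0; rewrite add0r.
have K0 : 0 < `|K| + 1 by rewrite ltr_pwDr.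
apply: (le_trans (ab (eps / (`|K| + 1)) _)); first exact: divr_gt0.
rewrite mulrCA ler_piMr//; first exact: ltW.
rewrite ler_pdivrMr// mul1r; apply: (le_trans (ler_norm K)).
by rewrite lerDl.
Qed.

(* [n D] is the weight of the configurations seen through D; the limit along D
   of its conditional probabilities exists uniformly. *)
Variable n : {fset V} -> conf V -> R.
Hypothesis n_gt0 : forall D w, 0 < n D w.

(** The Cauchy condition along growing windows, uniform in the configuration. *)
Definition settled L (eps : R) D := forall D', (D `<=` D')%fset ->
  forall w (x : {ffun L -> spin}),
    `|cond_weight (n D) w x - cond_weight (n D') w x| <= eps.

Hypothesis n_cauchy : forall L (eps : R), 0 < eps ->
  exists D0, forall D, (D0 `<=` D)%fset -> settled L eps D.

(** The supremum of all certified lower bounds; in this form no cofinal sequence of windows has to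
    be chosen. *)
Definition limit_weight L (x : {ffun L -> spin}) w : R :=
  sup [set a | exists eps D, [/\ 0 < eps, settled L eps D &
    a = cond_weight (n D) w x - eps]].

(** Two settled windows are compared through their union, so every certified lower bound lies below
    every certified upper bound. *)
Lemma limit_weightP L (eps : R) D : 0 < eps -> settled L eps D ->
  forall w (x : {ffun L -> spin}),
  `|cond_weight (n D) w x - limit_weight x w| <= eps.
Proof.
move=> eps0 Ds w x; rewrite /limit_weight; set A := (X in sup X).
have Aeps : A (cond_weight (n D) w x - eps) by exists eps, D.
have ubA e' D' : settled L e' D' -> ubound A (cond_weight (n D') w x + e').
  move=> D's _ [e [E [e0 Es ->]]].
  have := Es (E `|` D')%fset (fsubsetUl _ _) w x.
  have := D's (E `|` D')%fset (fsubsetUr _ _) w x.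
  rewrite !ler_distl => /andP[h1 h2] /andP[h3 h4]; lra.
have h1 : cond_weight (n D) w x - eps <= sup A.
  by apply: ub_le_sup => //; exists (cond_weight (n D) w x + eps); exact: ubA.
have h2 : sup A <= cond_weight (n D) w x + eps.
  by apply: ge_sup; [exists (cond_weight (n D) w x - eps)|exact: ubA].
by rewrite ler_distl; apply/andP; split; lra.
Qed.

Lemma limit_weight_near L (eps : R) : 0 < eps ->
  exists D0, forall D, (D0 `<=` D)%fset -> forall w (x : {ffun L -> spin}),
  `|cond_weight (n D) w x - limit_weight x w| <= eps.
Proof.
move=> eps0; have [D0 D0P] := n_cauchy L eps0.
by exists D0 => D /D0P Ds; exact: limit_weightP.
Qed.

Lemma limit_weight_ge0 L (x : {ffun L -> spin}) w : 0 <= limit_weight x w.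
Proof.
apply/ler_addgt0Pr => eps eps0; have [D0 D0P] := limit_weight_near L eps0.
have := D0P _ (fsubset_refl D0) w x; rewrite ler_distl => /andP[_ h].
by apply: le_trans h; apply: cond_weight_ge0.
Qed.

Lemma sum_dist_limit (L : {fset V}) (eps : R) (a b : {ffun L -> spin} -> R) :
  (forall x, `|a x - b x| <= eps) ->
  `|\sum_x a x - \sum_x b x| <= #|{ffun L -> spin}|%:R * eps.
Proof.
move=> ab; rewrite -sumrB; apply: (le_trans (ler_norm_sum _ _ _)).
rewrite -sum1_card natr_sum mulr_suml; apply: ler_sum => x _.
by rewrite mul1r.
Qed.

Lemma sum_limit_weight L w : \sum_(x : {ffun L -> spin}) limit_weight x w = 1.
Proof.
apply: (@eq_eps _ _ #|{ffun L -> spin}|%:R) => eps eps0.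
have [D0 D0P] := limit_weight_near L eps0.
rewrite -[X in _ - X](sum_cond_weight L w (n_gt0 D0)).
by apply: sum_dist_limit => x; rewrite distrC; apply: D0P.
Qed.

Lemma limit_weight_le1 L (x : {ffun L -> spin}) w : limit_weight x w <= 1.
Proof.
rewrite -(sum_limit_weight L w) (bigD1 x)//= lerDl sumr_ge0// => z _.
exact: limit_weight_ge0.
Qed.

(** The exact identity [cond_weight_consistent] in a common window [E] passes to the limit. On the
    left each of the [ND] terms is off by [NL * eps] from the inner weights and [eps] from the outer
    one; on the right, by [eps]. *)
Lemma limit_weight_consistent L D h (F : conf V -> R) :
  (forall w, `|F w| <= 1) -> (L `<=` D)%fset ->
  \sum_(y : {ffun D -> spin}) limit_weight y h *
    (\sum_(x : {ffun L -> spin}) limit_weight x (glue y h) *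
       F (glue x (glue y h))) =
  \sum_(y : {ffun D -> spin}) limit_weight y h * F (glue y h).
Proof.
move=> F1 LD.
set NL : R := #|{ffun L -> spin}|%:R; set ND : R := #|{ffun D -> spin}|%:R.
apply: (@eq_eps _ _ (ND * (1 + NL) + ND)) => eps eps0.
have [D1 D1P] := limit_weight_near L eps0.
have [D2 D2P] := limit_weight_near D eps0.
pose E := (D1 `|` D2)%fset.
have EL := D1P E (fsubsetUl _ _); have ED := D2P E (fsubsetUr _ _).
have FE u (c : R) : `|c * F u| <= `|c|.
  by rewrite normrM ler_piMr.
have cE : \sum_(y : {ffun D -> spin}) cond_weight (n E) h y *
    (\sum_(x : {ffun L -> spin}) cond_weight (n E) (glue y h) x *
       F (glue x (glue y h))) =
    \sum_(y : {ffun D -> spin}) cond_weight (n E) h y * F (glue y h).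
  have := cond_weight_consistent h F (n_gt0 E) LD.
  move=> /(congr1 (fun r => r / \sum_(z : {ffun D -> spin}) n E (glue z h))).
  rewrite !mulr_suml; under eq_bigr do rewrite mulrAC.
  by under [X in _ = X]eq_bigr do rewrite mulrAC.
set a := (X in `|X - _|); set b := (X in `|_ - X|).
set a' := (LHS) in cE; set b' := (RHS) in cE.
have aa' : `|a - a'| <= ND * ((1 + NL) * eps).
  apply: sum_dist_limit => y.
  set s := \sum_x limit_weight x _ * _; set s' := \sum_x cond_weight _ _ _ * _.
  have ss' : `|s - s'| <= NL * eps.
    apply: sum_dist_limit => x; rewrite -mulrBl (le_trans (FE _ _))//.
    by rewrite distrC.
  have s'1 : `|s'| <= 1.
    rewrite -(sum_cond_weight L (glue y h) (n_gt0 E)).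
    apply: (le_trans (ler_norm_sum _ _ _)); apply: ler_sum => x _.
    by rewrite (le_trans (FE _ _))// ger0_norm// cond_weight_ge0.
  have -> : limit_weight y h * s - cond_weight (n E) h y * s' =
    limit_weight y h * (s - s') + (limit_weight y h - cond_weight (n E) h y) *
      s'.
    by ring.
  have -> : (1 + NL) * eps = NL * eps + eps by ring.
  rewrite (le_trans (ler_normD _ _))// lerD// normrM.
    rewrite -[leRHS]mul1r ler_pM// ger0_norm ?limit_weight_le1//.
    exact: limit_weight_ge0.
  by rewrite -[leRHS]mulr1 ler_pM// distrC.
have bb' : `|b - b'| <= ND * eps.
  apply: sum_dist_limit => y; rewrite -mulrBl (le_trans (FE _ _))//.
  by rewrite distrC.
have -> : a - b = (a - a') - (b - b') by rewrite cE; ring.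
by rewrite (le_trans (ler_normB _ _))// [leRHS]mulrDl lerD// -mulrA.
Qed.

Lemma limit_weight_measurable L (x : {ffun L -> spin}) :
  (forall D, depends_on [set` D] (n D)) ->
  measurable_fun setT (limit_weight x : conf_on (~` [set` L]) -> R).
Proof.
move=> dn.
have /choice[E EP] : forall m : nat, exists D,
    forall w, `|cond_weight (n D) w x - limit_weight x w| <= m.+1%:R^-1.
  move=> m; have m0 : 0 < m.+1%:R^-1 :> R by rewrite invr_gt0.
  have [D DP] := limit_weight_near L m0; exists D => w.
  by apply: DP; exact: fsubset_refl.
apply: (@measurable_fun_cvg _ (conf_on (~` [set` L])) R setT
  (fun m w => cond_weight (n (E m)) w x)).
  (* Gluing overwrites the spins of [L], so the approximating weight reads its window only off
     [L]. *)
  move=> m; apply: (@depends_measurable_fun V _ (E m `\` L)%fset).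
    by move=> i /=; rewrite in_fsetD => /andP[/negP].
  move=> w w' ww'; have ww'' i : i \in E m -> i \notin L -> w i = w' i.
    by move=> iE iL; apply: ww' => /=; rewrite in_fsetD iL.
  have nE (z : {ffun L -> spin}) : n (E m) (glue z w) = n (E m) (glue z w').
    by apply: dn => i /= iE; apply: glue_congr => iL; apply: ww''.
  by rewrite /cond_weight nE; congr (_ / _); apply: eq_bigr => z _.
move=> w _; apply/cvgrPdist_le => e e0.
near=> m; rewrite distrC; apply: (le_trans (EP m w)).
near: m; have := @near_infty_natSinv_lt R (PosNum e0).
by apply: filterS => m /= /ltW.
Unshelve. all: by end_near.
Qed.

End thermodynamic_limit.

(** * A criterion for the Gibbs property *)

Section gibbs_criterion.
Variables (V : choiceType) (R : realType).
Implicit Types (L D : {fset V}) (w h : conf V).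

Lemma uniform_cvgP (g : nat -> conf V -> R) (f : conf V -> R) :
  {uniform, g @ \oo --> f} <->
  forall eps, 0 < eps -> exists N, forall m, (N <= m)%N -> forall w,
    `|f w - g m w| <= eps.
Proof.
split=> [gf eps eps0|gf].
  have : nbhs (f : {uniform` setT -> R}) [set u : conf V -> R |
      forall w, `|f w - u w| <= eps].
    apply/uniform_nbhs; exists [set xy | ball xy.1 eps xy.2]; split.
      exact: (entourage_ball _ (PosNum eps0)).
    by move=> u uf w; apply: ltW; exact: uf.
  by move=> /gf[N _ NP]; exists N => m Nm; exact: NP.
move=> P /uniform_nbhs[E [entE EP]].
move: entE; rewrite -entourage_ballE => -[e /= e0 eE].
have [|N NP] := gf (e / 2); first exact: divr_gt0.
exists N => // m /= Nm; apply: EP => w _; apply: eE => /=.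
rewrite /ball_/= /ball/=; apply: (le_lt_trans (NP m Nm w)).
by rewrite ltr_pdivrMr// mulr_natr mulr2n ltrDl.
Qed.

Lemma local_functionP (f : conf V -> R) :
  local_function f <-> exists L, depends_on [set` L] f.
Proof.
split=> -[L fL]; exists L; first exact: measurable_fun_depends.
exact: (@depends_measurable_fun V [set` L] L _ R f).
Qed.

Lemma quasilocal_measurable (f : conf V -> R) : quasilocal_function f ->
  measurable_fun setT f.
Proof.
move=> [g lg /uniform_cvgP gf].
apply: (@measurable_fun_cvg _ (conf V) R setT g) => [m|w _].
  by have /local_functionP[L dg] := lg m; exact: (depends_measurable_fun _ dg).
apply/cvgrPdist_le => eps /gf[N NP].
by exists N => // m /= /NP.
Qed.

Lemma local_bounded L (f : conf V -> R) : depends_on [set` L] f ->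
  exists M, forall w, `|f w| <= M.
Proof.
move=> df; pose h0 : conf V := fun=> Zero.
exists (\sum_(z : {ffun L -> spin}) `|f (glue z h0)|) => w.
rewrite (bigD1 (restr L w))//= (df w (glue (restr L w) h0)).
  by rewrite lerDl sumr_ge0.
by move=> k kL; rewrite -[k]/(val [` kL]%fset) glue_in ffunE.
Qed.

Lemma quasilocal_bounded (f : conf V -> R) : quasilocal_function f ->
  exists M, forall w, `|f w| <= M.
Proof.
move=> [g lg /uniform_cvgP gf]; have [N /(_ N (leqnn N)) NP] := gf 1 ltr01.
have /local_functionP[L /local_bounded[M MP]] := lg N.
exists (1 + M) => w; rewrite -[f w](subrK (g N w)).
by rewrite (le_trans (ler_normD _ _))// lerD.
Qed.

Lemma depends_sum_glue L D (a : {ffun L -> spin} -> conf V -> R)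
    (f : conf V -> R) :
  (forall x, depends_on [set` D] (a x)) -> depends_on [set` D] f ->
  depends_on [set` D] (fun w => \sum_x a x w * f (glue x w)).
Proof.
move=> da df w w' ww'; apply: eq_bigr => x _; rewrite (da x _ _ ww').
by congr (_ * _); apply: df => i iD; apply: glue_congr => _; exact: ww'.
Qed.

Lemma depends_cond_weight L D (n : conf V -> R) (x : {ffun L -> spin}) :
  depends_on [set` D] n -> depends_on [set` D] (fun w => cond_weight n w x).
Proof.
move=> dn w w' ww'; have nE (z : {ffun L -> spin}) : n (glue z w) = n (glue z
  w').
  by apply: dn => i iD; apply: glue_congr => _; exact: ww'.
by rewrite /cond_weight nE; congr (_ / _); apply: eq_bigr => z _.
Qed.

(** Cylinders generate the sigma-algebra, and two of them meet in a cylinder over the union or not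
    at all; the empty set is added to make this a pi-system. *)
Lemma cylinder_measure_unique (m1 m2 : {measure set (conf V) -> \bar R}) :
  (forall L w, m1 (cyl L w) = m2 (cyl L w)) -> (m1 setT < +oo)%E ->
  forall A, measurable A -> m1 A = m2 A.
Proof.
move=> m12 m1T; pose h0 : conf V := fun=> Zero.
pose G : set_system (conf V) := [set A | A = set0 \/ exists L w, A = cyl L w].
have cylT : cyl fset0 h0 = setT by apply/seteqP; split => // w _ k; rewrite inE.
apply: (@measure_unique _ _ _ G (fun=> setT)) => //.
- apply/seteqP; split.
    apply: sub_sigma_algebra2 => _ [i [s [_ ->]]]; right.
    exists [fset i]%fset, (fun=> s); apply/seteqP; split => w /=.
      by move=> wi k; rewrite inE => /eqP ->.
    by apply; rewrite inE.
  apply: smallest_sub; first exact: sigma_algebra_measurable.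
  by move=> _ [->|[L [w ->]]]; [exact: measurable0|exact: cyl_measurable].
- move=> A B [->|[L [w ->]]]; first by rewrite set0I; left.
  move=> [->|[D [w' ->]]]; first by rewrite setI0; left.
  have [E|/set0P[u [uw uw']]] := eqVneq (cyl L w `&` cyl D w') set0.
    by left.
  right; exists (L `|` D)%fset, u; apply/seteqP; split => v /=.
    move=> [vw vw'] k; rewrite inE => /orP[kL|kD].
      by rewrite vw// uw.
    by rewrite vw'// uw'.
  move=> vu; split => k kL; first by rewrite vu ?inE ?kL// uw.
  by rewrite vu ?inE ?kL ?orbT// uw'.
- by move=> _; right; exists fset0, h0.
- by rewrite bigcup_const//; exists 0%N.
- by move=> A [->|[L [w ->]]]; [rewrite !measure0|exact: m12].
Qed.

(** Averaging the kernel over [nu] gives a measure, so invariance need only be tested on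
    cylinders. *)
Lemma integral_kernel_unique (nu : probability (conf V) R) W
    (k : R.-pker conf_on W ~> conf V) :
  (forall L w, \int[nu]_u k u (cyl L w) = nu (cyl L w))%E ->
  forall A : set (conf V), measurable A -> (\int[nu]_u k u A = nu A)%E.
Proof.
move=> kcyl.
have mk A : measurable A -> measurable_fun setT (fun u : conf V => k u A).
  move=> mA; apply: (@measurable_fun_on V W setT) => //.
  exact: measurable_kernel.
pose m A := (\int[nu]_u k u A)%E.
have m0 : m set0 = 0%E by rewrite /m; under eq_integral do rewrite measure0;
  rewrite integral0.
have m_ge0 A : (0 <= m A)%E by exact: integral_ge0.
have m_sigma : semi_sigma_additive m.
  move=> U mU tU mUU; rewrite [X in _ --> X](_ : _ =
    (\int[nu]_u (\sum_(n <oo) k u (U n)))%E); last first.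
    apply: eq_integral => u _.
    by apply/esym/cvg_lim => //; exact/measure_semi_sigma_additive.
  apply/cvg_closeP; split.
    by apply: is_cvg_nneseries => n _ _; exact: integral_ge0.
  rewrite closeE// integral_nneseries// => n.
  exact: mk.
pose M := isMeasure.Build _ _ _ m m0 m_ge0 m_sigma.
pose mm : {measure set (conf V) -> \bar R} := HB.pack m M.
move=> A mA; apply: (@cylinder_measure_unique mm nu) => //.
rewrite /mm/= /m; under eq_integral do rewrite prob_kernel.
rewrite integral_cst// mul1e.
by apply: (le_lt_trans (probability_le1 nu measurableT)); rewrite ltry.
Qed.

End gibbs_criterion.

Lemma ge0_integral_close (V : choiceType) (R : realType)
    (nu : probability (conf V) R) (f g : conf V -> R) (eps : R) :
  measurable_fun setT f -> measurable_fun setT g -> 0 <= eps ->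
  (forall w, 0 <= f w) -> (forall w, 0 <= g w) ->
  (forall w, f w <= g w + eps) ->
  (\int[nu]_w (f w)%:E <= \int[nu]_w (g w)%:E + eps%:E)%E.
Proof.
move=> mf mg eps0 f0 g0 fg.
apply: (@le_trans _ _ (\int[nu]_w ((g w)%:E + cst eps%:E w))%E).
  apply: ge0_le_integral => //=.
  - by move=> w _; rewrite lee_fin.
  - exact/measurable_EFinP.
  - by apply: emeasurable_funD; [exact/measurable_EFinP|exact: measurable_cst].
  - by move=> w _; rewrite -EFinD lee_fin.
rewrite ge0_integralD//=; last 2 first.
- by move=> w _; rewrite lee_fin.
- exact/measurable_EFinP.
rewrite leeD2l// -[X in (X <= _)%E]/(\int[nu]_w cst eps%:E w)%E integral_cst//.
rewrite -[leRHS]mule1; apply: lee_wpmul2l; first by rewrite lee_fin.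
exact: (probability_le1 nu measurableT).
Qed.

(* Uniform convergence of the finite-volume conditional probabilities makes
   their limits a quasilocal specification. *)
Lemma gibbs_of_uniform_limit (V : choiceType) (R : realType)
    (nu : probability (conf V) R) :
  (forall L w, 0 < cylp nu L w) ->
  (forall L (eps : R), 0 < eps ->
    exists D0, forall D, (D0 `<=` D)%fset -> settled (cylp nu) L eps D) ->
  gibbs_measure nu.
Proof.
move=> npos ncauchy; set n := cylp nu in npos ncauchy *.
have dn (D : {fset V}) : depends_on [set` D] (n D) by move=> w w' ww';
  exact: cylp_congr.
pose c (L : {fset V}) (x : {ffun L -> spin}) w := limit_weight n x w.
have c0 L x w : 0 <= c L x w by exact: limit_weight_ge0.
have c1 L w : \sum_x c L x w = 1 by exact: sum_limit_weight.
have mc (L : {fset V}) (x : {ffun L -> spin}) : measurable_fun setT (c L x :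
  conf_on (~` [set` L]) -> R).
  exact: limit_weight_measurable.
pose g L := projT1 (cid (mixture_kernel (c0 L) (c1 L) (mc L))).
have gE L h A : g L h A = (\sum_x c L x h * \1_A (glue x h))%:E.
  by rewrite /g; case: cid => k /= [].
have gR L h (f : conf V -> R) : measurable_fun setT f ->
    Rintegral (g L h) setT f = \sum_x c L x h * f (glue x h).
  by rewrite /g; case: cid => k /= [_ + _]; apply.
have gI L h (f : conf V -> R) : measurable_fun setT f -> (forall w, 0 <= f w) ->
    (\int[g L h]_w (f w)%:E = (\sum_x c L x h * f (glue x h))%:E)%E.
  by rewrite /g; case: cid => k /= [_ _ +]; apply.
have mg L A : measurable A ->
    measurable_fun setT (fun w : conf V => \sum_x c L x w * \1_A (glue x w)).
  move=> mA; apply/measurable_EFinP.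
  apply: (eq_measurable_fun (fun w : conf V => g L w A)).
    by move=> w _; rewrite gE.
  apply: (@measurable_fun_on V (~` [set` L]) setT) => //.
  exact: measurable_kernel.
have g_ge0 L A w : 0 <= \sum_x c L x w * \1_A (glue x w).
  by apply: sumr_ge0 => x _; rewrite mulr_ge0.
exists g; split.
- split=> [L A FA h|L D LD A mA h].
    rewrite gE; congr EFin; rewrite -[RHS]mul1r -(c1 L h) mulr_suml.
    apply: eq_bigr => x _; congr (_ * _); rewrite !indicE; congr (_%:R);
      congr nat_of_bool.
    have E : A (glue x h) = A h.
      by apply: (sigma_site_depends FA) => i /negP iL; rewrite glue_out.
    by apply/idP/idP; rewrite !inE E.
  under eq_integral do rewrite gE.
  rewrite gI; [|exact: mg|exact: g_ge0].
  rewrite gE; congr EFin; apply: limit_weight_consistent => // w.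
  by rewrite ger0_norm// indicE; case: (_ \in _); rewrite //= ler01.
- move=> L f qf; have mf := quasilocal_measurable qf.
  have [M MP] := quasilocal_bounded qf.
  have [u lu /uniform_cvgP uf] := qf.
  have /choice[E EP] : forall m : nat, exists D,
      forall w (x : {ffun L -> spin}), `|cond_weight (n D) w x - c L x w| <=
        m.+1%:R^-1.
    move=> m; have m0 : 0 < m.+1%:R^-1 :> R by rewrite invr_gt0.
    have [D DP] := limit_weight_near ncauchy L m0; exists D.
    by apply: DP; exact: fsubset_refl.
  (* The local approximants cut off twice: the limit weight is replaced by the one of window [E m],
     and [f] by [u m]. *)
  exists (fun m w => \sum_(x : {ffun L -> spin}) cond_weight (n (E m)) w x * u m
    (glue x w)).
    move=> m; apply/local_functionP; have /local_functionP[S dS] := lu m.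
    exists (E m `|` S)%fset; apply: depends_sum_glue.
      move=> x; apply: (depends_onS (W := [set` E m])).
        by move=> i /= iE; rewrite inE iE.
      exact: depends_cond_weight.
    apply: depends_onS dS.
    by move=> i /= iE; rewrite inE iE orbT.
  apply/uniform_cvgP => eps eps0.
  set NL : R := #|{ffun L -> spin}|%:R.
  pose K := `|M| + 1; have K0 : 0 < K by rewrite ltr_pwDr.
  (* The [NL] weights are each off by [e] against values bounded by [K], and replacing [f] costs one
     further [e] since the weights sum to one. *)
  pose e := eps / (NL * K + 1).
  have NK0 : 0 < NL * K + 1 by rewrite ltr_wpDl// mulr_ge0// ltW.
  have e0 : 0 < e by rewrite divr_gt0.
  have [N1 N1P] := uf e e0.
  have [N2 _ N2P] := @near_infty_natSinv_lt R (PosNum e0).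
  exists (maxn N1 N2) => m; rewrite geq_max => /andP[m1 m2] w.
  rewrite gR//.
  have em : m.+1%:R^-1 <= e by apply: ltW; exact: N2P.
  rewrite -[leLHS]/(`|_|).
  have -> : \sum_x c L x w * f (glue x w) -
      \sum_(x : {ffun L -> spin}) cond_weight (n (E m)) w x * u m (glue x w) =
    \sum_(x : {ffun L -> spin}) ((c L x w - cond_weight (n (E m)) w x) * f (glue
      x w) +
      cond_weight (n (E m)) w x * (f (glue x w) - u m (glue x w))).
    by rewrite -sumrB; apply: eq_bigr => x _; ring.
  apply: (@le_trans _ _ (\sum_(x : {ffun L -> spin}) (e * K + cond_weight (n (E
    m)) w x * e))).
    apply: (le_trans (ler_norm_sum _ _ _)); apply: ler_sum => x _.
    rewrite (le_trans (ler_normD _ _))// lerD// normrM.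
      rewrite ler_pM//; first by rewrite distrC (le_trans (EP m w x)).
      by rewrite (le_trans (MP _))// (le_trans (ler_norm M))// lerDl.
    rewrite [X in X * _]ger0_norm ?cond_weight_ge0//.
    by rewrite ler_wpM2l ?cond_weight_ge0//; exact: N1P.
  rewrite big_split/= sumr_const -mulr_suml sum_cond_weight// -[_ *+
    _]mulr_natr.
  rewrite -/NL mul1r (_ : _ + _ = e * (NL * K + 1)); last by ring.
  by rewrite /e divfK// gt_eqF.
- move=> L A mA; apply: integral_kernel_unique => // S s.
  under eq_integral do rewrite gE.
  set F := \1_(cyl S s) : conf V -> R.
  have F01 w : 0 <= F w <= 1.
    by rewrite /F indicE; case: (_ \in _); rewrite /= ?ler01 ?lexx.
  have dF D : (S `<=` D)%fset -> depends_on [set` D] F.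
    move=> /fsubsetP SD w w' ww'; rewrite /F !indicE; congr (_%:R);
      congr nat_of_bool.
    by apply/idP/idP; rewrite !inE => ws k kS;
      rewrite -ws//; [apply/esym|]; apply: ww'; exact: SD.
  have h0 : conf V := fun=> Zero.
  (* In a window [D] containing [L] and [S], the weights are the exact conditional probabilities of
     [nu], so the approximation [f] has exactly the integral [nu (cyl S s)]. *)
  have key eps : 0 < eps -> exists2 f : conf V -> R,
     [/\ measurable_fun setT f, (forall w, 0 <= f w) &
      forall w, `|f w - \sum_x c L x w * F (glue x w)| <= eps]
     & (\int[nu]_w (f w)%:E = nu (cyl S s))%E.
    set NL : R := #|{ffun L -> spin}|%:R => eps0.
    have NL0 : 0 < NL + 1 by rewrite ltr_wpDl.
    have e0 : 0 < eps / (NL + 1) by rewrite divr_gt0.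
    have NLe : NL * (eps / (NL + 1)) <= eps.
      by rewrite mulrCA ler_piMr ?(ltW eps0)// ler_pdivrMr// mul1r lerDl.
    have [D0 D0P] := limit_weight_near ncauchy L e0.
    pose D := (D0 `|` (L `|` S))%fset.
    have SD : (S `<=` D)%fset by apply/fsubsetP => i iS; rewrite !inE iS !orbT.
    have LD : (L `<=` D)%fset by apply/fsubsetP => i iL; rewrite !inE iL !orbT.
    pose f w := \sum_(x : {ffun L -> spin}) cond_weight (n D) w x * F (glue x
      w).
    have df : depends_on [set` D] f.
      by apply: depends_sum_glue; [move=> x; exact: depends_cond_weight|exact:
        dF].
    have f0 w : 0 <= f w.
      apply: sumr_ge0 => x _; have /andP[F0 _] := F01 (glue x w).
      by rewrite mulr_ge0 ?cond_weight_ge0.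
    exists f; first split=> //.
    + exact: (depends_measurable_fun _ df).
    + move=> w; apply: le_trans NLe; apply: sum_dist_limit => x;
      rewrite -mulrBl normrM.
      have /andP[F0 F1] := F01 (glue x w).
      rewrite [X in _ * X]ger0_norm//.
      by rewrite (le_trans _ (D0P D (fsubsetUl _ _) w x))// ler_piMr.
    + rewrite (integral_depends nu h0 f0 df).
      transitivity ((\sum_(y : {ffun D -> spin}) F (glue y h0) * n D (glue y
        h0))%:E)%E.
        congr EFin; under eq_bigr do rewrite mulrC.
        rewrite cond_weight_consistent//.
        by apply: eq_bigr => y _; rewrite mulrC.
      rewrite -(integral_depends nu h0); [|by move=> w;
        have /andP[] := F01 w|exact: dF].
      by rewrite integral_indic ?setIT//; exact: cyl_measurable.
  apply/eqP; rewrite eq_le; apply/andP; split; apply/lee_addgt0Pr => eps eps0;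
    have [f [mf f0 fE] <-] := key _ eps0.
    apply: ge0_integral_close => [||||w|w]; [|exact: mf|exact: ltW|exact:
      g_ge0|exact: f0|].
      by apply: mg; exact: cyl_measurable.
    by have := fE w; rewrite ler_distl => /andP[+ _]; rewrite lerBlDr.
  apply: ge0_integral_close => [||||w|w]; [exact: mf| |exact: ltW|exact:
    f0|exact: g_ge0|].
    by apply: mg; exact: cyl_measurable.
  by have := fE w; rewrite ler_distl => /andP[_].
Qed.

(** * Conditioning in the Widom-Rowlinson model *)

Section widom_rowlinson.
Variables (V : choiceType) (R : realType) (e : rel V) (nb : V -> {fset V}).
Variables (beta lambda : R).
Hypothesis esym : symmetric e.
Hypothesis nbE : forall k j, (j \in nb k) = e k j.
Hypothesis lambda_gt0 : 0 < lambda.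
Implicit Types (L D S : {fset V}) (w h s : conf V).

Local Notation weight := (wr_weight e beta lambda).
Local Notation partition := (wr_partition e beta lambda).

Definition nbhd L : {fset V} := (L `|` \bigcup_(k <- L) nb k)%fset.

Lemma nbhdP L i : reflect (i \in L \/ exists2 k,
  k \in L & e k i) (i \in nbhd L).
Proof.
rewrite inE; apply: (iffP orP) => -[iL|]; try by left.
  by move=> /bigfcupP[k]; rewrite andbT => kL; rewrite nbE; right; exists k.
by move=> [k kL ki]; right; apply/bigfcupP; exists k; rewrite ?kL ?nbE.
Qed.

Lemma nbhd_sub L : (L `<=` nbhd L)%fset.
Proof. exact: fsubsetUl. Qed.

Lemma edges_meeting_nbhd L b i : edges_meeting e L b -> i \in b -> i \in nbhd L.
Proof.
move=> [[k [j [kj ->]]]] /fset0Pn[l lL] ii; apply/nbhdP.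
move: lL ii; rewrite !inE => /andP[ll lL] ii.
case/orP: ll lL => /eqP ->; case/orP: ii => /eqP -> lL; try by left.
  by right; exists k.
by right; exists j => //; rewrite esym.
Qed.

Lemma wr_weight_gt0 L h (x : {ffun L -> spin}) : 0 < weight h x.
Proof.
by rewrite mulr_gt0 ?expR_gt0// prodr_gt0// => k _; rewrite exprz_gt0.
Qed.

Lemma wr_partition_gt0 L h : 0 < partition L h.
Proof.
rewrite /wr_partition (bigD1 (restr L h))//= ltr_pwDl ?wr_weight_gt0//.
by rewrite sumr_ge0// => x _; rewrite ltW// wr_weight_gt0.
Qed.

Lemma wr_weight_congr L h h' (x : {ffun L -> spin}) :
  (forall i, i \in nbhd L -> i \notin L -> h i = h' i) ->
  weight h x = weight h' x.
Proof.
move=> hh'; rewrite /wr_weight; congr (expR (_ * _) * _).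
apply: eq_fsbigr => b; rewrite inE => bL; congr (_%:R).
congr (nat_of_bool (_ == _)); apply: eq_big_seq => i ib; congr int_of_spin.
apply: glue_congr => iL; apply: hh' => //.
exact: edges_meeting_nbhd ib.
Qed.

Lemma wr_partition_congr L h h' :
  (forall i, i \in nbhd L -> i \notin L -> h i = h' i) ->
  partition L h = partition L h'.
Proof. by move=> hh'; apply: eq_bigr => x _; exact: wr_weight_congr. Qed.

(** Every edge meeting [L] has a factor zero in its spin product. This makes the zero block a
    reference of weight 1 under every boundary condition. *)
Lemma wr_weight0 L h : weight h ([ffun=> Zero] : {ffun L -> spin}) = 1.
Proof.
rewrite /wr_weight big1 ?mulr1 => [|k _]; last by rewrite ffunE expr0n.
rewrite /wr_energy fsbig1 ?mulr0 ?expR0// => b /= [_ /fset0Pn[i]].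
rewrite inE => /andP[ib iL]; rewrite (big_rem i)//= -[i]/(val [` iL]%fset).
by rewrite glue_in ffunE mul0r.
Qed.

Variables (mu : probability (conf V) R) (g : kernel_family V R).
Hypothesis g_wr : wr_specification e beta lambda g.
Hypothesis g_mu : compatible g mu.

(** The specification is given on cylinders only. On the cylinder of [x], the event [A] coincides
    with the outside event [A'], to which properness assigns probability 0 or 1. *)
Lemma wr_kernelE L h A : measurable A ->
  g L h A = (\sum_(x : {ffun L -> spin})
    (partition L h)^-1 * weight h x * \1_A (glue x h))%:E.
Proof.
move=> mA; have [[gprop _] gcyl] := g_wr.
have mcyl x : measurable (local_cylinder x : set (conf V)).
  by rewrite (local_cylinderE x h); exact: cyl_measurable.
have -> : g L h A = (\sum_(x : {ffun L -> spin}) g L h (A `&` local_cylinder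
  x))%E.
  transitivity (\int[g L h]_w (\sum_(x : {ffun L -> spin})
      (\1_(A `&` local_cylinder x) w)%:E))%E.
    rewrite -[in LHS](setIT A) -integral_indic//; apply: eq_integral => w _.
    rewrite sumEFin; congr EFin; under eq_bigr do rewrite indicI/=.
    rewrite -mulr_sumr -[LHS]mulr1; congr (_ * _).
    rewrite (bigD1 (restr L w))//= big1 ?addr0.
      by rewrite indicE mem_set// => k; rewrite ffunE.
    move=> x xw; rewrite indicE memNset// => wx; case/eqP: xw.
    by apply/ffunP => k; rewrite ffunE.
  rewrite ge0_integral_sum//.
    by apply: eq_bigr => x _; rewrite integral_indic ?setIT//;
      exact: measurableI.
  by move=> x; apply/measurable_EFinP; apply: measurable_indic;
    exact: measurableI.
rewrite -sumEFin; apply: eq_bigr => x _.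
pose A' := glue x @^-1` A.
have FA' : <<s site_events (~` [set` L]) >> A'.
  have := @measurable_glue V L x measurableT A mA.
  by rewrite setTI.
have -> : A `&` local_cylinder x = A' `&` local_cylinder x.
  apply/seteqP; split => w [Aw wx]; split => //; move: Aw; rewrite /A'/=;
    by rewrite (_ : glue x w = w)//; apply: glueP.
have mA' : measurable (A' : set (conf V)) by apply: (@site_events_sub _ _ setT)
  FA'.
have gA' := gprop L A' FA' h.
rewrite indicE; have [xA|xA] := boolP (glue x h \in A).
  rewrite mulr1 -gcyl.
  have : g L h (~` A') = 0%E.
    rewrite gprop; last exact: sigma_algebraC.
    by rewrite indicE memNset// => nA; apply: nA; rewrite inE in xA.
  move=> gC; rewrite -[in RHS](setTI (local_cylinder x)) -(setUv A') setIUl.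
  rewrite measureU//; last first.
  - by rewrite setIACA setICr set0I.
  - by apply: measurableI => //; exact: measurableC.
  - exact: measurableI.
  rewrite [X in (_ + X)%E](_ : _ = 0%E) ?adde0//.
  apply/eqP; rewrite eq_le measure_ge0 andbT -gC le_measure ?inE//.
  - by apply: measurableI => //; exact: measurableC.
  - exact: measurableC.
rewrite mulr0; apply/eqP; rewrite eq_le measure_ge0 andbT.
apply: (@le_trans _ _ (g L h A')).
  by rewrite le_measure ?inE//; exact: measurableI.
by rewrite gA' indicE memNset// => h1; move/negP: xA; rewrite inE.
Qed.

Definition zero_conf : conf V := fun=> Zero.

(* The mean of F over the restrictions to S, extended by zero outside S. *)
Definition mean S (F : conf V -> R) : R :=
  \sum_(z : {ffun S -> spin}) cylp mu S (glue z zero_conf) * F (glue z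
    zero_conf).

Lemma mean_integral S (F : conf V -> R) : (forall w, 0 <= F w) ->
  depends_on [set` S] F -> (\int[mu]_w (F w)%:E = (mean S F)%:E)%E.
Proof.
move=> F0 dF; rewrite (integral_depends mu zero_conf F0 dF); congr EFin.
by apply: eq_bigr => z _; rewrite mulrC.
Qed.

(** The function $\gamma_L F$ as a finite sum, meaningful for any real [F]. *)
Definition average L (F : conf V -> R) w : R :=
  \sum_(x : {ffun L -> spin}) (partition L w)^-1 * weight w x * F (glue x w).

(** Compatibility for cylinder events, extended by linearity. An arbitrary [F] is allowed because
    [mean] evaluates only at configurations vanishing off [S], and resampling inside [L] stays among
    them. *)
Lemma mean_average L S (F : conf V -> R) : (nbhd L `<=` S)%fset ->
  mean S (average L F) = mean S F.
Proof.
move=> /fsubsetP LS; have LS' i : i \in L -> i \in S.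
  by move=> iL; apply: LS; apply: (fsubsetP (nbhd_sub L)).
have cylE z : cylp mu S (glue z zero_conf) =
    mean S (average L (\1_(cyl S (glue z zero_conf)))).
  apply: EFin_inj; rewrite -cylpE -(g_mu L (cyl_measurable S _)).
  rewrite -mean_integral.
  - by apply: eq_integral => w _; rewrite wr_kernelE//; exact: cyl_measurable.
  - move=> w; apply: sumr_ge0 => x _; rewrite mulr_ge0// mulr_ge0//.
      by rewrite invr_ge0 ltW// wr_partition_gt0.
    by rewrite ltW// wr_weight_gt0.
  - move=> w w' ww'; rewrite /average (wr_partition_congr (h' := w'));
    last first.
      by move=> i /LS iS _; exact: ww'.
    apply: eq_bigr => x _; rewrite (wr_weight_congr (h' := w')); last first.
      by move=> i /LS iS _; exact: ww'.
    congr (_ * _); rewrite !indicE; congr (_%:R); congr nat_of_bool.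
    apply/idP/idP; rewrite !inE => zw k kS; rewrite -zw//;
      [apply: glue_congr => _; apply/Logic.eq_sym|apply: glue_congr => _];
        exact: ww'.
rewrite [RHS]/mean; under [RHS]eq_bigr do rewrite cylE.
rewrite [RHS](eq_bigr (fun z => \sum_(y : {ffun S -> spin})
    cylp mu S (glue y zero_conf) * (\sum_(x : {ffun L -> spin})
     (partition L (glue y zero_conf))^-1 * weight (glue y zero_conf) x *
     (\1_(cyl S (glue z zero_conf)) (glue x (glue y zero_conf)) *
      F (glue z zero_conf))))); last first.
  move=> z _; rewrite /mean mulr_suml; apply: eq_bigr => y _.
  rewrite -mulrA; congr (_ * _); rewrite /average mulr_suml.
  by apply: eq_bigr => x _; exact: Logic.eq_sym (mulrA _ _ _).
rewrite exchange_big; apply: eq_bigr => y _ /=.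
rewrite -mulr_sumr; congr (_ * _); rewrite exchange_big;
  apply: eq_bigr => x _ /=.
rewrite -mulr_sumr; congr (_ * _).
(* [u] vanishes off [S], hence is one of the configurations summed over, and the sum over [z]
   reduces to that term. *)
set u := glue x _; have uE : glue (restr S u) zero_conf = u.
  apply: glue_restr => i iS; rewrite /u !glue_out//.
  by apply: contra iS; exact: LS'.
rewrite (bigD1 (restr S u))//= uE indicE mem_set; last exact: cyl_self.
rewrite mul1r big1 ?addr0// => z zu; rewrite indicE memNset ?mul0r// => uz.
case/eqP: zu; apply/ffunP => k.
by rewrite ffunE uz ?glue_in// fsvalP.
Qed.

End widom_rowlinson.

(** * Dobrushin's comparison *)

Section dobrushin.
Variables (V : choiceType) (R : realType) (nb : V -> {fset V}).
Implicit Types (A B S : {fset V}) (f : conf V -> R) (delta : V -> R).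

Definition oscillates f delta := forall j w w',
  (forall i, i != j -> w i = w' i) -> `|f w - f w'| <= delta j.

(** Stands in for an expectation: weighted means with nonnegative weights of total one have this
    property. *)
Definition averaging (E : (conf V -> R) -> R) := forall f c D,
  (forall w, `|c - f w| <= D) -> `|c - E f| <= D.

Lemma oscillates_ge0 f delta j : oscillates f delta -> 0 <= delta j.
Proof. by move=> /(_ j (fun=> Zero) (fun=> Zero) (fun _ _ => erefl));
  apply: le_trans. Qed.

(** The spins in [S] are changed one at a time, after replacing [w'] by a configuration equal to [w]
    off [S]. *)
Lemma oscillates_sum S f delta w w' : depends_on [set` S] f ->
  oscillates f delta -> `|f w - f w'| <= \sum_(j <- S) delta j.
Proof.
move=> df of_; pose u := glue (restr S w') w.
have -> : f w' = f u.
  by apply: df => k kS; rewrite /u -[k]/(val [` kS]%fset) glue_in ffunE.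
suff gen (s : seq V) (v v' : conf V) : (forall i, i \notin s -> v i = v' i) ->
    `|f v - f v'| <= \sum_(j <- s) delta j.
  by apply: gen => i iS; rewrite /u glue_out.
elim: s v v' => [|j s IH] v v' vv'.
  by rewrite big_nil (_ : v = v') ?subrr ?normr0//; apply/funext => i;
    exact: vv'.
pose t : conf V := fun i => if i == j then v' i else v i.
rewrite big_cons -[f v](subrK (f t)) -addrA (le_trans (ler_normD _ _))// lerD//.
  by apply: of_ => i /negbTE ij; rewrite /t ij.
apply: IH => i iS; rewrite /t; case: eqVneq => // ij.
by apply: vv'; rewrite inE negb_or ij.
Qed.

Definition nbhd_iter m B := iter m (nbhd nb) B.

Lemma nbhd_iter_sub m B : (B `<=` nbhd_iter m B)%fset.
Proof.
by elim: m => [|m IH]; [exact: fsubset_refl|apply: (fsubset_trans IH);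
  exact: nbhd_sub].
Qed.

Variables (A S : {fset V}) (E E' : (conf V -> R) -> R) (eps : R).
Variable G : V -> (conf V -> R) -> conf V -> R.
Hypothesis AS : (A `<=` S)%fset.
Hypothesis E_avg : averaging E.
Hypothesis E'_avg : averaging E'.
Hypothesis EG : forall k f, k \in A -> E (G k f) = E f.
Hypothesis E'G : forall k f, k \in A -> E' (G k f) = E' f.
Hypothesis G_local : forall k f, k \in A -> depends_on [set` S] f ->
  depends_on [set` S] (G k f).
Hypothesis G_osc : forall k f delta, oscillates f delta ->
  oscillates (G k f) (fun j =>
    if j == k then 0 else delta j + (j \in nb k)%:R * (eps * delta k)).
Hypothesis eps_ge0 : 0 <= eps.
Hypothesis eps_small : forall k, #|` nb k|%:R * eps <= 2^-1.

(** The coefficient vectors of Dobrushin's comparison: [a j] limits how much of the oscillation of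
    [f] at [j] the difference of the two expectations can feel. *)
Definition estimate (a : V -> R) := forall f delta, depends_on [set` S] f ->
  oscillates f delta -> `|E f - E' f| <= \sum_(j <- S) a j * delta j.

Lemma estimate_le a b : (forall j, a j <= b j) -> estimate a -> estimate b.
Proof.
move=> ab ea f delta df of_; apply: (le_trans (ea f delta df of_)).
by apply: ler_sum => j _; rewrite ler_wpM2r// (oscillates_ge0 _ of_).
Qed.

Lemma estimate1 : estimate (fun=> 1).
Proof.
move=> f delta df of_; under eq_bigr do rewrite mul1r.
by apply: E'_avg => w; rewrite distrC; apply: E_avg => w';
  exact: oscillates_sum.
Qed.

(* Replacing f by G k f trades the coefficient at k for half of a bound on
   the coefficients at its neighbours. *)
Lemma estimate_update a (M : R) k : k \in A -> 0 <= M ->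
  (forall j, j \in nb k -> a j <= M) -> (forall j, 0 <= a j) -> estimate a ->
  estimate (fun j => if j == k then 2^-1 * M else a j).
Proof.
move=> kA M0 aM a0 ea f delta df of_; have d0 j := oscillates_ge0 j of_.
have kS : k \in S by apply: (fsubsetP AS).
(* Both expectations are invariant under resampling at [k]. The new function no longer oscillates at
   [k], so the old coefficient there drops out; what remains was passed on to the neighbours. *)
rewrite -(EG f kA) -(E'G f kA).
apply: (le_trans (ea _ _ (G_local kA df) (G_osc k of_))).
rewrite (bigD1_seq k)//= eqxx mulr0 add0r [leRHS](bigD1_seq k)//= eqxx.
rewrite [leRHS]addrC.
apply: (@le_trans _ _ (\sum_(j <- S | j != k) a j * delta j +
   \sum_(j <- S | j != k) a j * ((j \in nb k)%:R * (eps * delta k)))).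
  rewrite -big_split/=; apply: ler_sum => j /negbTE ->.
  by rewrite mulrDr.
apply: lerD; first by apply: ler_sum => j /negbTE ->.
apply: (@le_trans _ _ (\sum_(j <- S) (j \in nb k)%:R * (M * (eps * delta k)))).
  rewrite big_mkcond/=; apply: ler_sum => j _; case: ifP => _; last first.
    by rewrite !mulr_ge0.
  case: (boolP (j \in nb k)) => jk; last by rewrite !mul0r mulr0.
  by rewrite !mul1r ler_wpM2r ?aM// mulr_ge0.
rewrite -mulr_suml.
have H : (\sum_(j <- S) (j \in nb k)%:R : R) <= #|` nb k|%:R.
  rewrite -natr_sum ler_nat -big_mkcond/= sum1_count -size_filter.
  apply: uniq_leq_size; first by rewrite filter_uniq.
  by move=> j; rewrite mem_filter => /andP[].
apply: (@le_trans _ _ ((#|` nb k|%:R * eps) * (M * delta k))).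
  rewrite -mulrA (mulrCA M) ler_wpM2r// mulr_ge0// mulr_ge0//.
rewrite -[leRHS]mulrA.
by rewrite ler_wpM2r// mulr_ge0.
Qed.

(** Induction on the number of layers: with coefficients at most [2^-1 ^+ m] on the neighbourhood of
    [B], the sites of [B] are updated one by one. Sites already updated only have smaller
    coefficients, so the bound on neighbours survives throughout. *)
Lemma estimate_nbhd m B : (nbhd_iter m B `<=` A)%fset ->
  estimate (fun j => if j \in B then 2^-1 ^+ m else 1).
Proof.
elim: m B => [|m IH] B BA.
  by apply: estimate_le estimate1 => j; case: ifP; rewrite ?expr0.
have {}IH := IH (nbhd nb B); rewrite /nbhd_iter -iterSr in IH.
have {}IH := IH BA.
set a := (X in estimate X) in IH.
have p0 : 0 <= 2^-1 ^+ m :> R by rewrite exprn_ge0.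
have p1 : 2^-1 ^+ m <= 1 :> R by rewrite exprn_ile1// invf_le1// ler1n.
have h0 : 0 <= 2^-1 ^+ m.+1 :> R by rewrite exprn_ge0.
have h1 : 2^-1 ^+ m.+1 <= 2^-1 ^+ m :> R by rewrite exprS ler_piMl// invf_le1//
  ler1n.
have a0 j : 0 <= a j by rewrite /a; case: ifP.
have a1 j : a j <= 1 by rewrite /a; case: ifP.
suff : estimate (fun j => if j \in (B : seq V) then 2^-1 ^+ m.+1 else a j).
  by apply: estimate_le => j; case: ifP.
have : {subset (B : seq V) <= B} by [].
elim: (B : seq V) => [|k s IHs] sB; first exact: IH.
have {}IHs : estimate (fun j => if j \in s then 2^-1 ^+ m.+1 else a j).
  by apply: IHs => j js; apply: sB; rewrite inE js orbT.
have kB : k \in B by apply: sB; rewrite inE eqxx.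
have kA : k \in A by apply: (fsubsetP BA); apply: (fsubsetP (nbhd_iter_sub m.+1
  B)).
apply: estimate_le (estimate_update kA p0 _ _ IHs) => [j|j jk|j].
- by rewrite inE exprS; case: eqVneq.
- case: ifP => // _; rewrite /a ifT//.
  rewrite inE; apply/orP; right; apply/bigfcupP; exists k => //.
  by rewrite kB.
- by case: ifP.
Qed.

End dobrushin.

(** * The initial spins given the evolved spins *)

Section pinned_model.
Variables (V : choiceType) (R : realType) (e : rel V) (nb : V -> {fset V}).
Variables (beta lambda : R).
Hypothesis esym : symmetric e.
Hypothesis nbE : forall k j, (j \in nb k) = e k j.
Hypothesis lambda_gt0 : 0 < lambda.
Variables (mu : probability (conf V) R) (g : kernel_family V R).
Hypothesis g_wr : wr_specification e beta lambda g.
Hypothesis g_mu : compatible g mu.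
Variable p : spin -> spin -> R.
Hypothesis p_ge0 : forall s r, 0 <= p s r.
Hypothesis p_diag : forall s, 0 < p s s.
Implicit Types (L D S : {fset V}) (w h : conf V).

Local Notation weight := (wr_weight e beta lambda).
Local Notation partition := (wr_partition e beta lambda).

(** For the flip probabilities, the probability that the initial [w] evolves into [h] on [D]. *)
Definition pin_prod D h w : R := \prod_(k <- D) p (w k) (h k).

Definition pin_weight L h w (x : {ffun L -> spin}) : R :=
  weight w x * \prod_(k : L) p (x k) (h (val k)).

Definition pin_sum L h w : R := \sum_(x : {ffun L -> spin}) pin_weight h w x.

(* The conditional mean of f given the initial configuration w off L and the
   evolved configuration h on L. *)
Definition pin L h (f : conf V -> R) w : R :=
  (\sum_(x : {ffun L -> spin}) pin_weight h w x * f (glue x w)) / pin_sum L h w.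

Lemma pin_prod_ge0 D h w : 0 <= pin_prod D h w.
Proof. by apply: prodr_ge0 => k _. Qed.

Lemma pin_prod_depends D h : depends_on [set` D] (pin_prod D h).
Proof. by move=> w w' ww'; apply: eq_big_seq => k kD; rewrite ww'. Qed.

Lemma pin_weight_ge0 L h w (x : {ffun L -> spin}) : 0 <= pin_weight h w x.
Proof. by rewrite mulr_ge0 ?prodr_ge0// ltW// wr_weight_gt0. Qed.

Lemma pin_sum_gt0 L h w : 0 < pin_sum L h w.
Proof.
rewrite /pin_sum (bigD1 (restr L h))//= ltr_pwDl//.
  by rewrite mulr_gt0 ?wr_weight_gt0// prodr_gt0// => k _; rewrite ffunE.
by rewrite sumr_ge0// => x _; exact: pin_weight_ge0.
Qed.

Lemma pin_weight_congr L h w w' (x : {ffun L -> spin}) :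
  (forall i, i \in nbhd nb L -> i \notin L -> w i = w' i) ->
  pin_weight h w x = pin_weight h w' x.
Proof. by move=> ww'; rewrite /pin_weight (wr_weight_congr beta lambda esym nbE
  x ww'). Qed.

Lemma pin_sum_congr L h w w' :
  (forall i, i \in nbhd nb L -> i \notin L -> w i = w' i) ->
  pin_sum L h w = pin_sum L h w'.
Proof. by move=> ww'; apply: eq_bigr => x _; exact: pin_weight_congr. Qed.

Lemma pin_depends L S h f : (nbhd nb L `<=` S)%fset -> depends_on [set` S] f ->
  depends_on [set` S] (pin L h f).
Proof.
move=> /fsubsetP LS df w w' ww'.
have ww i : i \in nbhd nb L -> i \notin L -> w i = w' i by move=> /LS iS _;
  exact: ww'.
rewrite /pin (pin_sum_congr h ww); congr (_ / _); apply: eq_bigr => x _.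
rewrite (pin_weight_congr h x ww); congr (_ * _); apply: df => i iS.
by apply: glue_congr => _; exact: ww'.
Qed.

Lemma pin_off L h f w w' : (forall i, i \notin L -> w i = w' i) ->
  pin L h f w = pin L h f w'.
Proof.
move=> ww'; have ww i : i \in nbhd nb L -> i \notin L -> w i = w' i by move=> _
  /ww'.
rewrite /pin (pin_sum_congr h ww); congr (_ / _); apply: eq_bigr => x _.
by rewrite (pin_weight_congr h x ww) (glue_off x ww').
Qed.

Lemma pin_prod_glue L D h w (x : {ffun L -> spin}) : (L `<=` D)%fset ->
  pin_prod D h (glue x w) = \prod_(k : L) p (x k) (h (val k)) *
    \prod_(k <- D | k \notin L) p (w k) (h k).
Proof.
move=> /fsubsetP LD; rewrite /pin_prod (bigID (mem L))/=; congr (_ * _).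
  transitivity (\prod_(k <- L) p (glue x w k) (h k)).
    rewrite -big_filter; apply: perm_big; apply: uniq_perm => //.
      by rewrite filter_uniq.
    by move=> k; rewrite mem_filter; case: (boolP (k \in L)) => //= /LD.
  by rewrite big_seq_fsetE/=; apply: eq_bigr => k _; rewrite glue_in.
by apply: eq_bigr => k kL; rewrite glue_out.
Qed.

Lemma average_pin_prod L D h (f : conf V -> R) w : (L `<=` D)%fset ->
  average e beta lambda L (fun u => f u * pin_prod D h u) w =
  (partition L w)^-1 * \prod_(k <- D | k \notin L) p (w k) (h k) *
    \sum_(x : {ffun L -> spin}) pin_weight h w x * f (glue x w).
Proof.
move=> LD; rewrite /average mulr_sumr; apply: eq_bigr => x _.
by rewrite pin_prod_glue// /pin_weight; ring.
Qed.

Let mean_averageE L S F : (nbhd nb L `<=` S)%fset ->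
  mean mu S (average e beta lambda L F) = mean mu S F.
Proof. exact: (mean_average esym nbE lambda_gt0 g_wr g_mu). Qed.

Lemma eq_mean S (F F' : conf V -> R) : F =1 F' -> mean mu S F = mean mu S F'.
Proof. by move=> FF'; apply: eq_bigr => z _; rewrite FF'. Qed.

(** Both sides are first averaged over the spins in [L] by $\gamma_L$. The value [pin L h f w] does
    not see these spins, so it factors out and cancels its own denominator. *)
Lemma mean_pin L D S h (f : conf V -> R) : (L `<=` D)%fset ->
  (nbhd nb L `<=` S)%fset ->
  mean mu S (fun w => pin L h f w * pin_prod D h w) =
  mean mu S (fun w => f w * pin_prod D h w).
Proof.
move=> LD LS; rewrite -(mean_averageE _ LS) -[RHS](mean_averageE _ LS).
apply: eq_mean => w; rewrite !average_pin_prod//; congr (_ * _).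
rewrite [LHS](eq_bigr (fun x => pin_weight h w x * pin L h f w)).
  by rewrite -mulr_suml /pin mulrC divfK// gt_eqF// pin_sum_gt0.
by move=> x _; congr (_ * _); apply: pin_off => i iL; rewrite glue_out.
Qed.

Lemma mean_gt0 S (F : conf V -> R) : (forall w, 0 < F w) -> 0 < mean mu S F.
Proof.
move=> F0; have c0 z : 0 <= cylp mu S (glue z (@zero_conf V)) * F (glue z
  (@zero_conf V)).
  by rewrite mulr_ge0 ?cylp_ge0// ltW.
rewrite lt_neqAle sumr_ge0// andbT; apply/negP.
rewrite eq_sym /mean psumr_eq0// => /allP h.
have := sum_cylp mu S (@zero_conf V); rewrite big1 => [/eqP|z _].
  by rewrite eq_sym oner_eq0.
have /implyP/(_ isT) := h z (mem_index_enum z).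
by rewrite mulf_eq0 (gt_eqF (F0 _)) orbF => /eqP.
Qed.

(** The product itself may vanish, but its average over the spins in [D] is positive everywhere,
    thanks to the term where the initial spins equal [h]. *)
Lemma mean_pin_prod_gt0 D S h : (nbhd nb D `<=` S)%fset ->
  0 < mean mu S (pin_prod D h).
Proof.
move=> DS; rewrite -(mean_averageE _ DS).
rewrite (@eq_mean _ _ (average e beta lambda D (fun u => 1 * pin_prod D h u))).
  apply: mean_gt0 => w; rewrite average_pin_prod ?fsubset_refl//.
  rewrite big_seq_cond big1 => [|k /andP[-> //]].
  rewrite mulr1 mulr_gt0 ?invr_gt0 ?wr_partition_gt0//.
  by under eq_bigr do rewrite mulr1; exact: pin_sum_gt0.
by move=> w; apply: eq_bigr => x _; rewrite mul1r.
Qed.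

(** The expectation of [f] under [mu] given that the evolved spins on [D] are [h]; [S] is the finite
    window in which it is computed. *)
Definition cond_mean S D h (f : conf V -> R) : R :=
  mean mu S (fun w => f w * pin_prod D h w) / mean mu S (pin_prod D h).

Lemma cond_mean_averaging S D h : (nbhd nb D `<=` S)%fset ->
  averaging (cond_mean S D h).
Proof.
move=> DS f c B fB; have m0 := mean_pin_prod_gt0 h DS.
have -> : c - cond_mean S D h f =
    mean mu S (fun w => (c - f w) * pin_prod D h w) / mean mu S (pin_prod D h).
  rewrite /cond_mean -[c in LHS](mulfK (lt0r_neq0 m0)) -mulrBl; congr (_ / _).
  by rewrite /mean mulr_sumr -sumrB; apply: eq_bigr => z _; ring.
rewrite normrM normfV (gtr0_norm m0) ler_pdivrMr//.
rewrite (le_trans (ler_norm_sum _ _ _))// mulr_sumr; apply: ler_sum => z _.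
rewrite !normrM (ger0_norm (cylp_ge0 _ _ _)) (ger0_norm (pin_prod_ge0 _ _ _)).
by rewrite mulrCA ler_wpM2r// mulr_ge0 ?cylp_ge0 ?pin_prod_ge0.
Qed.

Lemma cond_mean_pin L D S h f : (L `<=` D)%fset -> (nbhd nb L `<=` S)%fset ->
  cond_mean S D h (pin L h f) = cond_mean S D h f.
Proof. by move=> LD LS; rewrite /cond_mean mean_pin. Qed.

Hypothesis p_zero : forall s, p s Zero = (s == Zero)%:R.

(** By [p_zero] evolved zeros leave only the zero block, whose weight is 1 by [wr_weight0]. *)
Lemma pin_sum0 L h w : pin_sum L (glue ([ffun=> Zero] : {ffun L -> spin}) h) w =
  1.
Proof.
rewrite /pin_sum (bigD1 [ffun=> Zero])//= /pin_weight wr_weight0 mul1r.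
rewrite [X in X + _]big1 => [|k _]; last by rewrite glue_in !ffunE p_zero.
rewrite big1 ?addr0// => x x0.
have [k xk] : exists k, x k != Zero.
  apply/existsP; apply: contraR x0; rewrite negb_exists => /forallP xk.
  by apply/eqP/ffunP => k; rewrite ffunE; apply/eqP; move: (xk k);
    rewrite negbK.
by rewrite (bigD1 k)//= glue_in ffunE p_zero (negbTE xk) mul0r mulr0.
Qed.

(* The ratio of two evolved cylinder probabilities is a conditional mean of a
   function of the spins next to L only. *)
Lemma cond_mean_pin_sum L D S h (x : {ffun L -> spin}) : (L `<=` D)%fset ->
  (nbhd nb D `<=` S)%fset -> (nbhd nb L `<=` S)%fset ->
  mean mu S (pin_prod D (glue x h)) =
  mean mu S (pin_prod D (glue ([ffun=> Zero] : {ffun L -> spin}) h)) *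
  cond_mean S D (glue ([ffun=> Zero] : {ffun L -> spin}) h) (pin_sum L (glue x
    h)).
Proof.
move=> LD DS LS; rewrite /cond_mean mulrCA mulfV ?mulr1; last first.
  by rewrite gt_eqF// mean_pin_prod_gt0.
rewrite -(mean_averageE _ LS) -[RHS](mean_averageE _ LS).
rewrite (@eq_mean _ _ (average e beta lambda L (fun u => 1 * pin_prod D (glue x
  h) u))).
  apply: eq_mean => w; rewrite !average_pin_prod// -!mulrA; congr (_ * _).
  congr (_ * _); first by apply: eq_bigr => k kL; rewrite !glue_out.
  (* [pin_sum] does not depend on the spins in [L], so it leaves the sum, and the rest is 1 by
     [pin_sum0]. *)
  rewrite [RHS](eq_bigr (fun z => pin_weight (glue ([ffun=> Zero] : {ffun L ->
    spin}) h) w z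
     * pin_sum L (glue x h) w)); last first.
    move=> z _; congr (_ * _); apply: pin_sum_congr => i _ iL.
    by rewrite glue_out.
  have S1 := pin_sum0 L h w; rewrite {1}/pin_sum in S1.
  rewrite -[RHS]mulr_suml S1 mul1r.
  by apply: eq_bigr => z _; rewrite mulr1.
by move=> w; apply: eq_bigr => z _; rewrite mul1r.
Qed.

Variable eps : R.
Hypothesis pin_concentrated : forall k h w,
  \sum_(x : {ffun [fset k]%fset -> spin} | x != restr [fset k]%fset h)
    pin_weight h w x <= eps / 2 * pin_sum [fset k]%fset h w.

(** A change at [j] acts through [f], costing [delta j], and through the law of the resampled spin.
    The second effect needs [j] next to [k]; each of the two laws gives mass at most [eps / 2] to
    values other than [h k]. *)
Lemma pin_oscillates k h f delta : oscillates f delta ->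
  oscillates (pin [fset k]%fset h f) (fun j => if j == k then 0
    else delta j + (j \in nb k)%:R * (eps * delta k)).
Proof.
move=> of_ j w w' ww'; case: eqVneq => [jk|jk].
  rewrite (pin_off h f (w' := w')) ?subrr ?normr0// => i.
  by rewrite inE -jk; exact: ww'.
set K := [fset k]%fset; pose x0 := restr K h.
pose pi (u : conf V) (x : {ffun K -> spin}) := pin_weight h u x / pin_sum K h u.
have pi0 u x : 0 <= pi u x by rewrite divr_ge0 ?pin_weight_ge0// ltW//
  pin_sum_gt0.
have pi1 u : \sum_x pi u x = 1.
  by rewrite -mulr_suml divff// gt_eqF// pin_sum_gt0.
have pieps u : \sum_(x | x != x0) pi u x <= eps / 2.
  by rewrite -mulr_suml ler_pdivrMr ?pin_sum_gt0//; exact: pin_concentrated.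
have pinE u : pin K h f u = \sum_x pi u x * f (glue x u).
  by rewrite /pin mulr_suml; apply: eq_bigr => x _; rewrite mulrAC.
(* Both laws have total mass one, so the value of [f] at the pinned spin [x0] may be subtracted;
   this removes the one term in which the laws carry large mass. *)
have -> : pin K h f w - pin K h f w' =
    \sum_x pi w x * (f (glue x w) - f (glue x w')) +
    \sum_x (pi w x - pi w' x) * (f (glue x w') - f (glue x0 w')).
  have -> : \sum_x (pi w x - pi w' x) * (f (glue x w') - f (glue x0 w')) =
    \sum_x (pi w x - pi w' x) * f (glue x w') -
     (\sum_x pi w x - \sum_x pi w' x) * f (glue x0 w').
    rewrite -sumrB mulr_suml -sumrB; apply: eq_bigr => x _; ring.
  rewrite !pi1 subrr mul0r subr0 !pinE -sumrB -big_split;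
    apply: eq_bigr => x _ /=.
  by ring.
apply: (le_trans (ler_normD _ _)); apply: lerD.
  apply: (le_trans (ler_norm_sum _ _ _)).
  rewrite -[leRHS]mul1r -(pi1 w) mulr_suml; apply: ler_sum => x _.
  rewrite normrM ger0_norm// ler_wpM2l//; apply: of_ => i ij.
  by apply: glue_congr => _; exact: ww'.
have dk : 0 <= delta k := oscillates_ge0 k of_.
case: (boolP (j \in nb k)) => jnb; last first.
  rewrite mul0r big1 ?normr0// => x _; rewrite (_ : pi w x = pi w' x) ?subrr
    ?mul0r//.
  have ww i : i \in nbhd nb K -> i \notin K -> w i = w' i.
    move=> /(nbhdP nbE)[-> //|[l]]; rewrite inE => /eqP -> ki _; apply: ww'.
    by apply: contraNneq jnb => <-; rewrite nbE.
  by rewrite /pi (pin_weight_congr h x ww) (pin_sum_congr h ww).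
rewrite mul1r; apply: (le_trans (ler_norm_sum _ _ _)).
rewrite (bigD1 x0)//= subrr mulr0 normr0 add0r.
apply: (@le_trans _ _ (\sum_(x | x != x0) (pi w x + pi w' x) * delta k)).
  apply: ler_sum => x _; rewrite normrM ler_pM//.
    by rewrite (le_trans (ler_normB _ _))// !ger0_norm.
  by apply: of_ => i ik; rewrite !glue_out// inE.
rewrite -mulr_suml ler_wpM2r// big_split/= [leRHS]splitr lerD//; exact: pieps.
Qed.

End pinned_model.

(** * Convergence of the conditional probabilities *)

Lemma exists_geometric_le (R : realType) (K eps : R) : 0 < eps ->
  exists n : nat, K * 2^-1 ^+ n <= eps.
Proof.
move=> eps0; exists (Num.bound `|K / eps|); set n := Num.bound _.
have Kn : K / eps <= n%:R.
  by rewrite (le_trans (ler_norm _))// ltW// archi_boundP.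
rewrite exprVn ler_pdivrMr ?exprn_gt0// mulrC -ler_pdivrMr//.
by rewrite (le_trans Kn)// -natrX ler_nat ltnW// ltn_expl.
Qed.

(** Compares normalised weights. The lower bounds 1 on the denominators come from the zero
    reference. *)
Lemma ratio_close (R : realType) (a b A B eta N : R) :
  0 <= b -> b <= B -> 1 <= A -> 1 <= B -> `|a - b| <= eta -> `|A - B| <= N * eta
    ->
  `|a / A - b / B| <= (1 + N) * eta.
Proof.
move=> b0 bB A1 B1 ab AB.
have A0 : 0 < A by exact: lt_le_trans A1.
have B0 : 0 < B by exact: lt_le_trans B1.
have iA : A^-1 <= 1 by rewrite invf_le1.
have iB : b / B <= 1 by rewrite ler_pdivrMr// mul1r.
have -> : a / A - b / B = (a - b) * A^-1 + b / B * (B - A) * A^-1.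
  by field; rewrite !gt_eqF.
have iA0 : 0 <= A^-1 by rewrite invr_ge0 ltW.
rewrite (le_trans (ler_normD _ _))// [leRHS]mulrDl mul1r lerD//.
  by rewrite normrM (ger0_norm iA0) -[leRHS]mulr1 ler_pM.
rewrite !normrM (ger0_norm iA0) normfV (gtr0_norm B0) (ger0_norm b0).
rewrite -[leRHS]mulr1 ler_pM// ?mulr_ge0 ?invr_ge0 ?(ltW B0)//.
rewrite -[leRHS]mul1r ler_pM// ?mulr_ge0 ?invr_ge0 ?(ltW B0)//.
by rewrite distrC.
Qed.

Section evolved_measure.
Variables (V : choiceType) (R : realType) (e : rel V) (nb : V -> {fset V}).
Variables (beta lambda : R).
Hypothesis esym : symmetric e.
Hypothesis nbE : forall k j, (j \in nb k) = e k j.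
Hypothesis lambda_gt0 : 0 < lambda.
Variables (mu : probability (conf V) R) (g : kernel_family V R).
Hypothesis g_wr : wr_specification e beta lambda g.
Hypothesis g_mu : compatible g mu.
Variable p : spin -> spin -> R.
Hypothesis p_ge0 : forall s r, 0 <= p s r.
Hypothesis p_diag : forall s, 0 < p s s.
Hypothesis p_zero : forall s, p s Zero = (s == Zero)%:R.
Variable eps : R.
Hypothesis eps_ge0 : 0 <= eps.
Hypothesis eps_small : forall k, #|` nb k|%:R * eps <= 2^-1.
Hypothesis pin_concentrated : forall k h w,
  \sum_(x : {ffun [fset k]%fset -> spin} | x != restr [fset k]%fset h)
    pin_weight e beta lambda p h w x <=
  eps / 2 * pin_sum e beta lambda p [fset k]%fset h w.
Variable nu : probability (conf V) R.
Hypothesis nuE : forall D S h, (D `<=` S)%fset ->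
  cylp nu D h = mean mu S (pin_prod p D h).
Implicit Types (L D S : {fset V}) (w h : conf V).

Local Notation zero L := ([ffun=> Zero] : {ffun L -> spin}).
Local Notation psum := (pin_sum e beta lambda p).
Local Notation cmean := (cond_mean mu p).

Lemma nbhd_mono L D : (L `<=` D)%fset -> (nbhd nb L `<=` nbhd nb D)%fset.
Proof.
move=> /fsubsetP LD; apply/fsubsetP => i /(nbhdP nbE)[iL|[k kL ki]];
  apply/(nbhdP nbE); first by left; exact: LD.
by right; exists k => //; exact: LD.
Qed.

Lemma cylp_evolved_gt0 D h : 0 < cylp nu D h.
Proof.
rewrite (nuE h (nbhd_sub nb D)).
exact: (mean_pin_prod_gt0 esym nbE lambda_gt0 g_wr g_mu p_ge0 p_diag h
  (fsubset_refl _)).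
Qed.

Lemma pin_sum_depends L h : depends_on [set` nbhd nb L] (psum L h).
Proof. by move=> w w' ww'; apply: (pin_sum_congr beta lambda esym nbE p h) => i
  iL _; exact: ww'. Qed.

(** [pin_sum L (glue x h)] reads the evolved configuration on [L] only, where it is [x]; this leaves
    finitely many local functions. *)
Lemma pin_sum_bounded L : exists B : R, 0 <= B /\
  forall h w (x : {ffun L -> spin}), psum L (glue x h) w <= B.
Proof.
have /choice[M MP] : forall x : {ffun L -> spin}, exists M,
    forall w, `|psum L (glue x (@zero_conf V)) w| <= M.
  by move=> x; apply: local_bounded; exact: pin_sum_depends.
exists (\sum_x `|M x|); split=> [|h w x]; first exact: sumr_ge0.
have -> : psum L (glue x h) w = psum L (glue x (@zero_conf V)) w.
  apply: eq_bigr => z _; congr (_ * _); apply: eq_bigr => k _.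
  by rewrite !glue_in.
rewrite (bigD1 x)//= (le_trans (ler_norm _))// (le_trans (MP x w))//.
by rewrite (le_trans (ler_norm _))// lerDl sumr_ge0.
Qed.

(** Conditioning in [D] or in [D'] leaves the same single-site resampling at every site of [D], so
    the comparison runs over the [m] layers around [nbhd nb L]. The tested function takes values in
    [[0, B]], hence oscillates by at most [B], and only on [nbhd nb L]. *)
Lemma cond_mean_close L m D D' S h (x : {ffun L -> spin}) (B : R) : 0 <= B ->
  (forall h w (x : {ffun L -> spin}), psum L (glue x h) w <= B) ->
  (nbhd_iter nb m (nbhd nb L) `<=` D)%fset -> (D `<=` D')%fset ->
  (nbhd nb D' `<=` S)%fset ->
  `|cmean S D h (psum L (glue x h)) - cmean S D' h (psum L (glue x h))| <=
    #|` nbhd nb L|%:R * B * 2^-1 ^+ m.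
Proof.
move=> B0 BP LD DD' D'S.
have nbD k : k \in D -> (nbhd nb [fset k] `<=` S)%fset.
  move=> kD; apply: fsubset_trans D'S; apply: nbhd_mono.
  by rewrite fsub1set; apply: (fsubsetP DD').
have DS : (nbhd nb D `<=` S)%fset by apply: fsubset_trans D'S; exact: nbhd_mono.
have LS : (nbhd nb L `<=` S)%fset.
  apply: (fsubset_trans (nbhd_iter_sub nb m _)); apply: (fsubset_trans LD).
  by apply: (fsubset_trans (nbhd_sub nb D)).
have sub1 (k : V) E : k \in E -> ([fset k] `<=` E)%fset by rewrite fsub1set.
have est : estimate S (cmean S D h) (cmean S D' h)
    (fun j => if j \in nbhd nb L then 2^-1 ^+ m else 1).
  apply: (@estimate_nbhd V R nb D S _ _ eps
    (fun k => pin e beta lambda p [fset k]%fset h)) => //.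
  - exact: fsubset_trans (nbhd_sub nb D) DS.
  - exact: (cond_mean_averaging esym nbE lambda_gt0 g_wr g_mu p_ge0 p_diag).
  - exact: (cond_mean_averaging esym nbE lambda_gt0 g_wr g_mu p_ge0 p_diag).
  - move=> k f kD.
    exact: (cond_mean_pin esym nbE lambda_gt0 g_wr g_mu p_ge0 p_diag h f
      (sub1 _ _ kD) (nbD k kD)).
  - move=> k f kD; have kD' := fsubsetP DD' _ kD.
    exact: (cond_mean_pin esym nbE lambda_gt0 g_wr g_mu p_ge0 p_diag h f
      (sub1 _ _ kD') (nbD k kD)).
  - move=> k f kD; exact: (pin_depends beta lambda esym nbE p h (nbD k kD)).
  - move=> k f delta.
    exact: (pin_oscillates esym nbE lambda_gt0 p_ge0 p_diag pin_concentrated).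
pose delta i : R := (i \in nbhd nb L)%:R * B.
apply: (le_trans (est _ delta _ _)).
- by apply: (depends_onS (W := [set` nbhd nb L]));
  [exact/fsubsetP|exact: pin_sum_depends].
- move=> j w w' ww'; rewrite /delta; case: (boolP (j \in nbhd nb L)) => jL.
    have F0 u : 0 <= psum L (glue x h) u by rewrite ltW// pin_sum_gt0.
    have FB u := BP h u x.
    have := F0 w; have := F0 w'; have := FB w; have := FB w'.
    by rewrite mul1r ler_norml => ? ? ? ?; apply/andP; split; lra.
  rewrite mul0r (@pin_sum_depends L (glue x h) w w') ?subrr ?normr0//.
  by move=> i /= iL; apply: ww'; apply: contraNneq jL => <-.
rewrite (_ : \sum_(j <- S) _ =
    \sum_(j <- S) (j \in nbhd nb L)%:R * (B * 2^-1 ^+ m)); last first.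
  by apply: eq_bigr => j _; rewrite /delta; case: (j \in nbhd nb L);
    rewrite ?mul1r ?mul0r ?mulr0 1?mulrC.
rewrite -mulr_suml -mulrA ler_wpM2r ?mulr_ge0 ?exprn_ge0//.
rewrite -natr_sum ler_nat -big_mkcond/= sum1_count -size_filter.
apply: uniq_leq_size; first by rewrite filter_uniq.
by move=> j; rewrite mem_filter => /andP[].
Qed.

Lemma evolved_settled L (eta : R) : 0 < eta ->
  exists D0, forall D, (D0 `<=` D)%fset -> settled (cylp nu) L eta D.
Proof.
move=> eta0; have [B [B0 BP]] := pin_sum_bounded L.
set N : R := #|{ffun L -> spin}|%:R.
have [m mP] := exists_geometric_le ((1 + N) * (#|` nbhd nb L|%:R * B)) eta0.
exists (nbhd_iter nb m (nbhd nb L)) => D LD D' DD' w x.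
(* The reference: [w] with zeros put on [L]. The factor [cylp nu E h] is common to all spins on [L]
   and cancels in the conditional weights. *)
pose h := glue (zero L) w.
have LL : (L `<=` nbhd_iter nb m (nbhd nb L))%fset.
  by apply: (fsubset_trans (nbhd_sub nb L)); exact: nbhd_iter_sub.
pose S := nbhd nb D'.
have key E : (nbhd_iter nb m (nbhd nb L) `<=` E)%fset -> (E `<=` D')%fset ->
  [/\ forall z : {ffun L -> spin}, 0 <= cmean S E h (psum L (glue z h)),
   1 <= \sum_(z : {ffun L -> spin}) cmean S E h (psum L (glue z h)) &
   forall z : {ffun L -> spin}, cond_weight (cylp nu E) w z =
    cmean S E h (psum L (glue z h)) /
    \sum_(y : {ffun L -> spin}) cmean S E h (psum L (glue y h))].
  move=> LE ED'; have ES : (nbhd nb E `<=` S)%fset by exact: nbhd_mono.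
  have ES' : (E `<=` S)%fset by exact: fsubset_trans (nbhd_sub nb E) ES.
  have LE' := fsubset_trans LL LE.
  have LS : (nbhd nb L `<=` S)%fset.
    by apply: fsubset_trans ES; exact: nbhd_mono.
  have nE (z : {ffun L -> spin}) : cylp nu E (glue z w) =
      cylp nu E h * cmean S E h (psum L (glue z h)).
    rewrite !(nuE _ ES') -(glue_glue z (zero L) w) -/h.
    rewrite (cond_mean_pin_sum esym nbE lambda_gt0 g_wr g_mu p_ge0 p_diag p_zero
      h z LE' ES LS).
    by rewrite (_ : glue (zero L) h = h)// /h glue_glue.
  have h0 := cylp_evolved_gt0 E h.
  have c0 (z : {ffun L -> spin}) : 0 <= cmean S E h (psum L (glue z h)).
    by rewrite -(pmulr_rge0 _ h0) -nE cylp_ge0.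
  (* The reference has ratio 1 to itself, which bounds the normalising sum below by 1. *)
  have c1 : cmean S E h (psum L (glue (zero L) h)) = 1.
    apply: (mulfI (lt0r_neq0 h0)); rewrite -nE mulr1//.
  split=> [//||z].
    by rewrite (bigD1 (zero L))//= c1 lerDl sumr_ge0.
  rewrite /cond_weight nE (eq_bigr _ (fun z _ => nE z)) -mulr_sumr.
  by rewrite -mulf_div divff ?mul1r// gt_eqF.
have [c0 c1 cE] := key D LD DD'.
have [c0' c1' cE'] := key D' (fsubset_trans LD DD') (fsubset_refl _).
rewrite cE cE'; apply: le_trans mP; rewrite -mulrA.
have close (z : {ffun L -> spin}) := cond_mean_close h z B0 BP LD DD'
  (fsubset_refl _).
apply: ratio_close => //.
- by rewrite (bigD1 x)//= lerDl sumr_ge0.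
- exact: sum_dist_limit.
Qed.

Lemma evolved_gibbs : gibbs_measure nu.
Proof.
by apply: gibbs_of_uniform_limit; [exact: cylp_evolved_gt0|exact:
  evolved_settled].
Qed.

End evolved_measure.

(** * Small times *)

Section spin_flip.
Variables (R : realType) (t : R).
Hypothesis t_ge0 : 0 <= t.

Lemma flip_diff_le : 1 - expR (- 2 * t) <= 2 * t.
Proof. by have := expR_ge1Dx (- 2 * t); lra. Qed.

Lemma flip_prob_ge0 s r : 0 <= flip_prob t s r.
Proof.
have h1 : expR (- 2 * t) <= 1.
  by rewrite -[leRHS]expR0 ler_expR mulNr oppr_le0 mulr_ge0.
have h0 := expR_ge0 (- 2 * t).
by rewrite /flip_prob !addr_ge0// mulr_ge0// mulr_ge0//; lra.
Qed.

Lemma flip_prob_diag s : 2^-1 <= flip_prob t s s.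
Proof.
have h0 := expR_ge0 (- 2 * t).
by case: s; rewrite /flip_prob /= ?mulr1 ?mulr0 ?addr0 ?add0r; lra.
Qed.

Lemma flip_prob_off s r : s != r -> flip_prob t s r <= t.
Proof.
have t0 := t_ge0; have h := flip_diff_le.
by case: s; case: r => // _; rewrite /flip_prob /= ?mulr1 ?mulr0 ?addr0 ?add0r;
  lra.
Qed.

Lemma flip_prob_zero s : flip_prob t s Zero = (s == Zero)%:R.
Proof. by rewrite /flip_prob eqxx andbF mulr0 /= mulr0 /= mulr0 !add0r andbT.
  Qed.

End spin_flip.

(** * Weights at a single site of degree [d + 1] *)

Section single_site_weight.
Variables (V : choiceType) (R : realType) (e : rel V) (nb : V -> {fset V}).
Variables (beta lambda : R) (d : nat).
Hypothesis esym : symmetric e.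
Hypothesis nbE : forall k j, (j \in nb k) = e k j.
Hypothesis nb_card : forall k, #|` nb k| = d.+1.
Hypothesis beta_gt0 : 0 < beta.
Hypothesis lambda_gt0 : 0 < lambda.

Lemma wr_energy_single k w : 0 <= wr_energy R e [fset k]%fset w <= d.+1%:R.
Proof.
have sub : edges_meeting e [fset k]%fset `<=` [set` [fset [fset k;
  j]%fset | j in nb k]%fset].
  move=> _ [[i [j [ij ->]]]] /fset0Pn[l]; rewrite !inE => /andP[].
  move=> /orP[]/eqP -> /eqP lk; apply/imfsetP => /=.
    by exists j; rewrite ?nbE -?lk.
  by exists i; rewrite ?nbE -?lk ?(esym j)// fsetUC.
have fin : finite_set (edges_meeting e [fset k]%fset).
  by apply: sub_finite_set sub _; exact: finite_fset.
rewrite /wr_energy fsbig_finite//=; apply/andP; split; first exact: sumr_ge0.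
apply: (@le_trans _ _ (\sum_(b <- fset_set (edges_meeting e [fset k]%fset)) 1)).
  by apply: ler_sum => b _; case: (_ == _).
rewrite big_const_seq count_predT iter_addr_0 ler_nat -(nb_card k).
apply: (@leq_trans #|` [fset [fset k; j] | j in nb k]%fset|); last first.
  exact: leq_imfset_card.
apply: fsubset_leq_card; apply/fsubsetP => b; rewrite in_fset_set// inE.
exact: sub.
Qed.

Lemma wr_weight_single k h (x : {ffun [fset k]%fset -> spin}) :
  Num.min 1 lambda * expR (- beta * d.+1%:R) <= wr_weight e beta lambda h x <=
  Num.max 1 lambda.
Proof.
have /andP[E0 E1] := wr_energy_single k (glue x h).
pose k0 : [fset k]%fset := [` fset11 k]%fset.
rewrite /wr_weight (bigD1 k0)//= big1 ?mulr1 => [|i ik]; last first.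
  case/eqP: ik; apply: val_inj => /=; apply/eqP.
  by have := fsvalP i; rewrite inE.
set l := lambda ^ _; have [l1 l2] : Num.min 1 lambda <= l /\ l <= Num.max 1
  lambda.
  by rewrite /l; case: (x k0) => /=; rewrite ge_min le_max ?lexx ?orbT.
have l0 : 0 <= Num.min 1 lambda by rewrite le_min ler01 ltW.
set E := wr_energy _ _ _ _ in E0 E1 *.
apply/andP; split.
  rewrite mulrC ler_pM ?expR_ge0// ler_expR !mulNr lerN2 ler_wpM2l// ltW//.
rewrite -[leRHS]mul1r ler_pM ?expR_ge0//; first exact: le_trans l1.
by rewrite -[leRHS]expR0 ler_expR mulNr oppr_le0 mulr_ge0// ltW.
Qed.

(** Each wrong value has weight at most [M * t], counted crudely over all three spins as
    [3 * (M * t)]; the right value alone has weight at least [m / 2]. The constant 12 makes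
    [12 * M * t / m / 2] times [m / 2] equal to [3 * (M * t)]. *)
Lemma pin_concentrated_single (t : R) k h w : 0 <= t ->
  \sum_(x : {ffun [fset k]%fset -> spin} | x != restr [fset k]%fset h)
    pin_weight e beta lambda (flip_prob t) h w x <=
  (12 * Num.max 1 lambda * t / (Num.min 1 lambda * expR (- beta * d.+1%:R))) / 2
    *
    pin_sum e beta lambda (flip_prob t) [fset k]%fset h w.
Proof.
move=> t0; set M := Num.max 1 lambda; set m := _ * expR _.
have m0 : 0 < m by rewrite mulr_gt0 ?expR_gt0// lt_min ltr01.
have M0 : 0 <= M by rewrite le_max ler01.
pose k0 : [fset k]%fset := [` fset11 k]%fset.
have prodE (x : {ffun [fset k]%fset -> spin}) :
    \prod_(i : [fset k]%fset) flip_prob t (x i) (h (val i)) = flip_prob t (x k0)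
      (h k).
  rewrite (bigD1 k0)//= big1 ?mulr1 => [//|i ik].
  case/eqP: ik; apply: val_inj => /=; apply/eqP.
  by have := fsvalP i; rewrite inE.
have up : \sum_(x : {ffun [fset k]%fset -> spin} | x != restr [fset k]%fset h)
    pin_weight e beta lambda (flip_prob t) h w x <= 3 * (M * t).
  apply: (@le_trans _ _ (\sum_(x : {ffun [fset k]%fset -> spin}) M * t)).
    rewrite big_mkcond/=; apply: ler_sum => x _; case: ifP => xh;
      last by rewrite mulr_ge0.
    have /andP[w0 wM] := wr_weight_single w x.
    rewrite /pin_weight prodE ler_pM ?flip_prob_ge0//;
      first exact: le_trans (ltW m0) w0.
    apply: flip_prob_off => //; apply: contraTneq xh => xk.
    rewrite negbK; apply/eqP/ffunP => i; rewrite ffunE.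
    have -> : i = k0 by apply: val_inj => /=; apply/eqP; have := fsvalP i;
      rewrite inE.
    exact: xk.
  rewrite sumr_const card_ffun -cardfE cardfs1 expn1.
  rewrite (_ : #|{: spin}| = 3%N); first by rewrite mulr_natl.
  by rewrite cardE enumT unlock.
have low : m / 2 <= pin_sum e beta lambda (flip_prob t) [fset k]%fset h w.
  rewrite /pin_sum (bigD1 (restr [fset k]%fset h))//= -[leLHS]addr0 lerD//.
    have /andP[w0 _] := wr_weight_single w (restr [fset k]%fset h).
    rewrite /pin_weight prodE ffunE ler_pM ?(ltW m0)// ?invr_ge0//.
    exact: flip_prob_diag.
  apply: sumr_ge0 => x _; apply: pin_weight_ge0 => // s r.
  exact: flip_prob_ge0.
apply: (le_trans up).
apply: (@le_trans _ _ (12 * M * t / m / 2 * (m / 2))).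
  have -> : 12 * M * t / m / 2 * (m / 2) = 3 * (M * t) by field; rewrite gt_eqF.
  by [].
by rewrite ler_wpM2l// !mulr_ge0// invr_ge0 ltW.
Qed.

End single_site_weight.

Lemma cayley_neighbours (d : nat) (V : choiceType) (e : rel V) :
  cayley_tree d e ->
  exists nb : V -> {fset V}, (forall k j, (j \in nb k) = e k j) /\
    forall k, #|` nb k| = d.+1.
Proof.
move=> [_ _ _ _ reg]; exists (fun k => fset_set [set j | e k j]).
have fin k : finite_set [set j | e k j] by exists d.+1; exact: reg.
split=> [k j|k]; last exact: card_fset_set.
by rewrite in_fset_set//; apply/idP/idP; rewrite inE.
Qed.

Theorem theorem2p12 (R : realType) (d : nat) (beta lambda : R) :
  (0 < d)%N -> 0 < beta -> 0 < lambda ->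
  exists tg : \bar R, (0 < tg)%E /\
    forall (V : choiceType) (e : rel V), cayley_tree d e ->
    forall t : R, 0 <= t -> (t%:E < tg)%E ->
    forall mu mut : probability (conf V) R,
      intermediate_measure e beta lambda mu ->
      time_evolved t mu mut ->
      gibbs_measure mut.
Proof.
move=> _ beta0 lambda0.
pose M := Num.max 1 lambda; pose m := Num.min 1 lambda * expR (- beta *
  d.+1%:R).
have m0 : 0 < m by rewrite mulr_gt0 ?expR_gt0// lt_min ltr01.
have M0 : 0 < M by rewrite lt_max ltr01.
(* Solves [d.+1%:R * (12 * M * t / m) = 2^-1] for [t], the contraction condition of the
   comparison. *)
pose tg := m / (24 * M * d.+1%:R).
have d0 : 0 < d.+1%:R :> R by [].
have Md0 : 0 < 24 * M * d.+1%:R by rewrite !mulr_gt0.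
exists tg%:E; split; first by rewrite lte_fin divr_gt0.
move=> V e tree t t0; rewrite lte_fin ltr_pdivlMr// => ttg mu mut.
move=> [[g g_wr g_mu] _ _ _] [K KE mutE].
have [nb [nbE nb_card]] := cayley_neighbours tree.
have esym := cayley_sym tree.
pose p := flip_prob t; pose eps := 12 * M * t / m.
have p_ge0 : forall s r, 0 <= p s r by exact: flip_prob_ge0.
have p_diag s : 0 < p s s by apply: lt_le_trans (flip_prob_diag t s);
  rewrite invr_gt0.
have eps0 : 0 <= eps by rewrite /eps !mulr_ge0 ?invr_ge0// ltW.
have eps_small k : #|` nb k|%:R * eps <= 2^-1.
  rewrite nb_card /eps mulrA ler_pdivrMr//.
  rewrite (_ : d.+1%:R * _ = 2^-1 * (t * (24 * M * d.+1%:R))); last by field.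
  by rewrite ler_wpM2l// ltW.
apply: (evolved_gibbs esym nbE lambda0 g_wr g_mu p_ge0 p_diag (flip_prob_zero t)
  eps0 eps_small).
  by move=> k h w; exact: pin_concentrated_single.
(* It remains to see that evolved cylinder probabilities are means of [pin_prod]: the product kernel
   evaluated at a cylinder is this product. *)
move=> D S h DS; apply: EFin_inj; rewrite -cylpE.
rewrite mutE; last exact: cyl_measurable.
rewrite -mean_integral; last 2 first.
- exact: pin_prod_ge0.
- by apply: depends_onS (pin_prod_depends p h); exact/fsubsetP.
apply: eq_integral => w _.
have -> : cyl D h = local_cylinder (restr D h).
  by rewrite (local_cylinderE _ h) glue_restr.
rewrite KE; congr EFin; rewrite /pin_prod big_seq_fsetE/=.
by apply: eq_bigr => k _; rewrite ffunE.
Qed.
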